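(* Let $\Omega$ be the metric graph, with all edges of the same thickness, consisting of four vertices $\mathrm P_1,\mathrm Q_1,\mathrm Q_2,\mathrm P_2$, one edge $\mathrm P_1\mathrm Q_1$, one edge $\mathrm P_1\mathrm Q_2$, two edges joining $\mathrm Q_1$ and $\mathrm P_2$, two edges joining $\mathrm Q_2$ and $\mathrm P_2$, an outer path $\Omega_1$ of infinite length emanating from $\mathrm P_1$ and an outer path $\Omega_2$ of infinite length emanating from $\mathrm P_2$. Assume that $$F(1)+(2^2-1)F(a)>0>F(1)+(4^2-1)F(a).$$ If the edges joining $\mathrm P_1$ to $\mathrm Q_1$, $\mathrm P_1$ to $\mathrm Q_2$, $\mathrm P_2$ to $\mathrm Q_1$ and $\mathrm P_2$ to $\mathrm Q_2$ are all sufficiently long, then $$\mathcal P(1,2)=1,\qquad\mathcal P(2,1)=0.$$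
   Context: At a vertex $V$ with incident edges $E_1,\ldots,E_m$, $\frac{\partial u}{\partial\nu_k}(V)$ denotes the derivative of $u$ at $V$ along $E_k$ (identified with an interval $[0,L]$ or $[0,\infty)$) in the direction pointing from $V$ into the interior of $E_k$; since all edges have the same thickness, the Kirchhoff condition at $V$ is $\sum_{k=1}^m\frac{\partial u}{\partial\nu_k}(V)=0$. Each outer path $\Omega_i$ has coordinate $x_i\in[0,\infty)$ with $x_i=0$ at the vertex from which it emanates. Nonlinearity: $f\in C^1$ and for some $0<a<1$: $f(0)=f(a)=f(1)=0$, $f<0$ on $(0,a)$, $f>0$ on $(a,1)$, $f'(0)<0$, $f'(a)>0$, $f'(1)<0$, $\int_0^1f(s)\,ds>0$. $F(s)=\int_0^sf(r)\,dr$. Solution of $\partial_tu=\Delta_\Omega u+f(u)$ on a time interval: a function $u(t,x)$ continuous in $(t,x)$ that satisfies $\partial_tu=\partial_x^2u+f(u)$ on each edge except at endpoints, with $\partial_xu$ continuous on each edge up to the endpoints, and the Kirchhoff condition at every vertex. Traveling wave: $(\phi,c)$, $c>0$, is the unique pair with $\phi''+c\phi'+f(\phi)=0$ and $0<\phi<1$ on $\mathbb R$, $\phi(-\infty)=1$, $\phi(+\infty)=0$, $\phi(0)=a$. Front-like solution and limit profile: for each $i$ there is a unique entire solution $\widehat u_i$ (defined for all $t\in\mathbb R$) with $0<\widehat u_i<1$ and $\lim_{t\to-\infty}\big(\sup_{x_i\in\Omega_i}|\widehat u_i|_{\Omega_i}(t,x_i)-\phi(-x_i-ct)|+\sup_{\Omega\setminus\Omega_i}|\widehat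 u_i(t,\cdot)|\big)=0$; it is strictly increasing in $t$. The limit profile is $\widehat v_i(x)=\lim_{t\to\infty}\widehat u_i(t,x)$. Propagation index: for $i\ne j$, $\lim_{x_j\to\infty}\widehat v_i|_{\Omega_j}(x_j)$ exists and equals $1$ or $0$; $\mathcal P(i,j)$ is this value ($1$: propagation from $\Omega_i$ to $\Omega_j$; $0$: blocking). *)

(* Defs.v *)
From HB Require Import structures.
From mathcomp Require Import all_boot all_order all_algebra.
From mathcomp Require Import all_classical all_reals all_analysis.

Set Implicit Arguments.
Unset Strict Implicit.
Unset Printing Implicit Defensive.

Import Order.TTheory GRing.Theory Num.Theory.
Import numFieldNormedType.Exports.

Local Open Scope classical_set_scope.
Local Open Scope ring_scope.

(* $F(s) = \int_0^s f(r) dr$, with the usual orientation for [s < 0]. *)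
Definition potential (R : realType) (f : R -> R) (s : R) : R :=
  if 0 <= s then \int[@lebesgue_measure R]_(r in `[0, s]) f r
  else - \int[@lebesgue_measure R]_(r in `[s, 0]) f r.

Record bistable (R : realType) (f : R -> R) (a : R) : Prop := Bistable {
  bistable_derivable : forall s : R, derivable f s 1;
  bistable_C1 : continuous (derive1 f);
  bistable_a_gt0 : 0 < a;
  bistable_a_lt1 : a < 1;
  bistable_f0 : f 0 = 0;
  bistable_fa : f a = 0;
  bistable_f1 : f 1 = 0;
  bistable_neg : forall s : R, 0 < s < a -> f s < 0;
  bistable_pos : forall s : R, a < s < 1 -> 0 < f s;
  bistable_df0 : derive1 f 0 < 0;
  bistable_dfa : 0 < derive1 f a;
  bistable_df1 : derive1 f 1 < 0;
  bistable_int : 0 < potential f 1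
}.

Record traveling_wave (R : realType) (f : R -> R) (a : R)
    (phi : R -> R) (c : R) : Prop := TravelingWave {
  tw_speed : 0 < c;
  tw_derivable : forall z : R, derivable phi z 1;
  tw_derivable2 : forall z : R, derivable (derive1 phi) z 1;
  tw_eq : forall z : R,
    derive1 (derive1 phi) z + c * derive1 phi z + f (phi z) = 0;
  tw_range : forall z : R, 0 < phi z < 1;
  tw_left : phi z @[z --> -oo] --> (1 : R);
  tw_right : phi z @[z --> +oo] --> (0 : R);
  tw_norm : phi 0 = a
}.

(* Finitely many vertices, bounded edges and outer paths; multiple edges and
   loops are allowed.  The bounded edge [e] is identified with
   [[0, mg_len e]], the coordinate [0] being at [mg_src e] and [mg_len e] at
   [mg_tgt e]; the outer path [o] is identified with [[0, +oo[], the
   coordinate [0] being at [mg_root o].  All edges have the same thickness. *)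
Record metric_graph (R : realType) := MetricGraph {
  mg_vertex : finType;
  mg_inner : finType;
  mg_outer : finType;
  mg_src : mg_inner -> mg_vertex;
  mg_tgt : mg_inner -> mg_vertex;
  mg_len : mg_inner -> R;
  mg_len_gt0 : forall e, 0 < mg_len e;
  mg_root : mg_outer -> mg_vertex
}.

Section MetricGraphs.
Context {R : realType} (G : metric_graph R).
Implicit Types (v : mg_vertex G) (i j o : mg_outer G).

Definition mg_edge : Type := (mg_inner G + mg_outer G)%type.
Implicit Types (e : mg_edge).

Definition edge_set e : set R :=
  match e with
  | inl b => `[0, mg_len b]%classic
  | inr _ => `[0, +oo[%classic
  end.

Definition edge_interior e : set R :=
  match e with
  | inl b => `]0, mg_len b[%classic
  | inr _ => `]0, +oo[%classic
  end.

(* A function on the graph is a family [w] of functions of the edge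
   coordinates, of which only the values [w e x] with [edge_set e x] are
   meaningful, and which takes a single value at each vertex. *)
Definition agree_at_vertices (w : mg_edge -> R -> R) : Prop :=
  exists wV : mg_vertex G -> R,
    (forall b : mg_inner G,
       w (inl b) 0 = wV (mg_src b) /\ w (inl b) (mg_len b) = wV (mg_tgt b)) /\
    (forall o : mg_outer G, w (inr o) 0 = wV (mg_root o)).

(* [d] is the derivative of [g] at [x] relative to the set [A]: one-sided at
   an endpoint of an interval, two-sided at an interior point. *)
Definition is_derive_within (A : set R) (g : R -> R) (x d : R) : Prop :=
  (g y - g x) / (y - x) @[y --> within A x^'] --> d.

(* [p] is the family of derivatives along the edge coordinates.  Each end of an
   edge at [v] contributes its derivative in the direction pointing from [v]
   into the edge, which is [- p] at the end of coordinate [mg_len b]. *)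
Definition kirchhoff (p : mg_edge -> R -> R) v : Prop :=
  \sum_(b : mg_inner G | mg_src b == v) p (inl b) 0
  + \sum_(b : mg_inner G | mg_tgt b == v) (- p (inl b) (mg_len b))
  + \sum_(o : mg_outer G | mg_root o == v) p (inr o) 0 = 0.

Record entire_solution (f : R -> R) (u : R -> mg_edge -> R -> R) : Prop :=
  EntireSolution {
  es_vertices : forall t, agree_at_vertices (u t);
  es_continuous : forall e,
    {within [set z : R * R | edge_set e z.2],
       continuous (fun z : R * R => u z.1 e z.2)};
  es_derivable_t : forall (t : R) e (x : R), edge_interior e x ->
    derivable (fun s : R => u s e x) t 1;
  es_derivable_x : forall (t : R) e (x : R), edge_interior e x ->
    derivable (u t e) x 1;
  es_derivable_xx : forall (t : R) e (x : R), edge_interior e x ->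
    derivable (derive1 (u t e)) x 1;
  es_eq : forall (t : R) e (x : R), edge_interior e x ->
    derive1 (fun s : R => u s e x) t =
      derive1 (derive1 (u t e)) x + f (u t e x);
  es_kirchhoff : forall t, exists p : mg_edge -> R -> R,
    [/\ forall e x, edge_set e x ->
          is_derive_within (edge_set e) (u t e) x (p e x),
        forall e, {within edge_set e, continuous (p e)}
      & forall v, kirchhoff p v]
}.

Record front_like_solution (f phi : R -> R) (c : R) i
    (u : R -> mg_edge -> R -> R) : Prop := FrontLikeSolution {
  fl_solution : entire_solution f u;
  fl_range : forall (t : R) e (x : R), edge_set e x -> 0 < u t e x < 1;
  fl_limit :
    sup [set `|u t (inr i) x - phi (- x - c * t)| | x in edge_set (inr i)]
    + sup [set y | exists e (x : R),
             [/\ e <> inr i, edge_set e x & y = `|u t e x|]]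
      @[t --> -oo] --> (0 : R)
}.

Definition limit_profile (u : R -> mg_edge -> R -> R)
    (w : mg_edge -> R -> R) : Prop :=
  forall e x, edge_set e x -> u t e x @[t --> +oo] --> w e x.

(* [propagation_index f phi c i j r] says that $\mathcal P(i, j) = r$.  The
   front-like solution [u] coming from the outer path [i] is unique and
   converges, so that [u] and its limit profile [w] are introduced by their
   characteristic properties; the existence of the limit of [w] along the outer
   path [j] is part of the assertion. *)
Definition propagation_index (f phi : R -> R) (c : R) i j (r : R) : Prop :=
  forall (u : R -> mg_edge -> R -> R) (w : mg_edge -> R -> R),
    front_like_solution f phi c i u -> limit_profile u w ->
    w (inr j) x @[x --> +oo] --> r.

End MetricGraphs.

Inductive vertex := P1 | Q1 | Q2 | P2.
Inductive inner_edge := P1Q1 | P1Q2 | Q1P2a | Q1P2b | Q2P2a | Q2P2b.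
Inductive outer_path := Omega1 | Omega2.

Definition nat_of_vertex x : nat :=
  match x with P1 => 0 | Q1 => 1 | Q2 => 2 | P2 => 3 end.
Definition vertex_of_nat n : vertex := nth P1 [:: P1; Q1; Q2; P2] n.
Lemma nat_of_vertexK : cancel nat_of_vertex vertex_of_nat.
Proof. by case. Qed.
HB.instance Definition _ := Countable.copy vertex (can_type nat_of_vertexK).
Lemma vertex_enumP : Finite.axiom [:: P1; Q1; Q2; P2].
Proof. by case. Qed.
HB.instance Definition _ := fintype.isFinite.Build vertex vertex_enumP.

Definition nat_of_inner_edge x : nat :=
  match x with
  | P1Q1 => 0 | P1Q2 => 1 | Q1P2a => 2 | Q1P2b => 3 | Q2P2a => 4 | Q2P2b => 5
  end.
Definition inner_edge_of_nat n : inner_edge :=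
  nth P1Q1 [:: P1Q1; P1Q2; Q1P2a; Q1P2b; Q2P2a; Q2P2b] n.
Lemma nat_of_inner_edgeK : cancel nat_of_inner_edge inner_edge_of_nat.
Proof. by case. Qed.
HB.instance Definition _ :=
  Countable.copy inner_edge (can_type nat_of_inner_edgeK).
Lemma inner_edge_enumP :
  Finite.axiom [:: P1Q1; P1Q2; Q1P2a; Q1P2b; Q2P2a; Q2P2b].
Proof. by case. Qed.
HB.instance Definition _ := fintype.isFinite.Build inner_edge inner_edge_enumP.

Definition nat_of_outer_path x : nat :=
  match x with Omega1 => 0 | Omega2 => 1 end.
Definition outer_path_of_nat n : outer_path := nth Omega1 [:: Omega1; Omega2] n.
Lemma nat_of_outer_pathK : cancel nat_of_outer_path outer_path_of_nat.
Proof. by case. Qed.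
HB.instance Definition _ :=
  Countable.copy outer_path (can_type nat_of_outer_pathK).
Lemma outer_path_enumP : Finite.axiom [:: Omega1; Omega2].
Proof. by case. Qed.
HB.instance Definition _ := fintype.isFinite.Build outer_path outer_path_enumP.

Definition inner_edge_src (e : inner_edge) : vertex :=
  match e with
  | P1Q1 | P1Q2 => P1
  | Q1P2a | Q1P2b => Q1
  | Q2P2a | Q2P2b => Q2
  end.

Definition inner_edge_tgt (e : inner_edge) : vertex :=
  match e with
  | P1Q1 => Q1
  | P1Q2 => Q2
  | Q1P2a | Q1P2b | Q2P2a | Q2P2b => P2
  end.

Definition outer_path_root (o : outer_path) : vertex :=
  match o with Omega1 => P1 | Omega2 => P2 end.

Definition one_way_graph (R : realType) (len : inner_edge -> R)
    (len_gt0 : forall e, 0 < len e) : metric_graph R :=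
  @MetricGraph R vertex inner_edge outer_path
    inner_edge_src inner_edge_tgt len len_gt0 outer_path_root.

(* Main.v *)
Require Import Defs.
From mathcomp Require Import all_boot all_order all_algebra.
From mathcomp Require Import all_classical all_reals all_analysis.
From mathcomp Require Import ring lra.
Import Order.TTheory GRing.Theory Num.Theory.
Import numFieldNormedType.Exports.
Local Open Scope classical_set_scope.
Local Open Scope ring_scope.
Set Implicit Arguments.
Unset Strict Implicit.
Unset Printing Implicit Defensive.

(** The theorem is proved by comparing the front-like solution with explicit
stationary or slowly moving profiles; nothing about parabolic equations is
needed beyond the fact that a solution and a strict sub- or supersolution
cannot touch for the first time ([first_contact], [comparison_below],
[comparison_above]).  At such a contact the two space derivatives agree and the
second ones are ordered, which contradicts the strict differential inequality;
at a vertex the one-sided derivatives are ordered on every incident edge, which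
contradicts a strict Kirchhoff inequality.  Profiles only have to admit, at
each point, a smooth test function on the right side of them, so that
plateaus, minima of profiles and kinks of the harmless sign are allowed.

The profiles are built from one family, the ramps ([ramp_exists]): solutions of
E'' = - psi(E) with E'^2 / 2 = Psi(th) - Psi(E), Psi' = psi, that rise from 0
and reach the level th, with slope 0, at a finite distance d.

Passing ([propagation_passes]).  Take psi = f - eta with a small eta > 0, so
that ramps are strict subsolutions even when they move slowly.  Since
F(1) + 3 F(a) > 0 there are levels thB < thA < 1 such that the ramp reaching
thA is more than twice as steep as the ramp reaching thB at every common height
([passing_parameters]).  Hence a front made of the first ramp on p incoming
edges and of the second one on at most 2 p outgoing edges satisfies the strict
Kirchhoff inequality at all heights, and may slide through the vertex
([front_crosses_vertex]).  Behind it the solution stays above thB > a, and on a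
long edge the reaction lifts it above thA again ([raise_lower_bound]), which
feeds the next vertex.  The vertices P1 (1 edge in, 2 out), Q1 and Q2 (1 in,
2 out), P2 (4 in, 1 out) all qualify.  Each lower bound holds for all large
times, so the lengths of the edges may differ: at P2 one waits for the last of
the four fronts.  On the second outer path the same lifting works up to every
level below 1, since there all lengths are available.

Blocking ([propagation_blocked]).  A stationary supersolution is equal to 1 far
out on the second outer path, decreases to a at P2 along a ramp, and decreases
further, along each of the four edges, to a small constant m that is kept on
the rest of the graph.  It exists if the slope of the first part is at most
four times the slope of the second one, that is, up to small errors, if
F(1) - F(a) <= 16 (F(0) - F(a)).  It dominates the solution at very negative
times, hence always ([stationary_supersolution]).  On the first outer path the
solution is then at most m for all times, where f(s) <= - kap s, so that the
limit profile decays exponentially ([exponential_decay]). *)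

(** * First contact on a finite family of intervals *)

Section Contact.
Context {R : realType}.

Lemma zero_set_compact (g : R * R -> R) (t0 t1 al be : R) :
  {within `[t0, t1] `*` `[al, be], continuous g} ->
  compact (`[t0, t1] `*` `[al, be] `&` [set z | g z <= 0]).
Proof.
move=> gc.
have cl0 : closed [set y : R | y <= 0] by exact: closed_le.
have : closed ((g @^-1` [set y | y <= 0]) : set (subspace (`[t0, t1] `*` `[al, be]))).
  exact: (proj1 (continuous_closedP _) gc _ cl0).
move=> /closed_subspaceP[V cV VE].
have -> : `[t0, t1] `*` `[al, be] `&` [set z | g z <= 0]
    = `[t0, t1] `*` `[al, be] `&` V by rewrite setIC [RHS]setIC VE.
apply: compact_closedI cV.
by apply: compact_setX; exact: segment_compact.
Qed.

(** The points where some [d i] is nonpositive form a compact set, so that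
there is a first time at which this happens; it is enough to exclude what is
then seen at that time. *)
Lemma first_contact (I : finType) (al be : I -> R) (t0 t1 : R)
    (d : I -> R -> R -> R) :
  (forall i, {within `[t0, t1] `*` `[al i, be i],
     continuous (fun z : R * R => d i z.1 z.2)}) ->
  (forall i x, al i <= x <= be i -> 0 < d i t0 x) ->
  (forall t i x, t0 < t <= t1 -> al i <= x <= be i -> d i t x = 0 ->
     (forall j y, al j <= y <= be j -> 0 <= d j t y) ->
     (forall s, t0 <= s < t -> 0 < d i s x) -> False) ->
  forall t i x, t0 <= t <= t1 -> al i <= x <= be i -> 0 < d i t x.
Proof.
move=> dc d0 nocontact t i x tt xx; rewrite ltNge; apply/negP => dle0.
pose Z j := `[t0, t1] `*` `[al j, be j] `&` [set z : R * R | d j z.1 z.2 <= 0].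
have Zc j : compact (Z j) by exact: zero_set_compact.
have ZP j s y : Z j (s, y) <-> [/\ t0 <= s <= t1, al j <= y <= be j & d j s y <= 0].
  split=> [[[/= ]]|[h1 h2 h3]]; first by rewrite !in_itv.
  by split => //; split; rewrite /= in_itv.
have min_time j : Z j !=set0 -> exists tau, (exists y, Z j (tau, y)) /\
    forall s z, Z j (s, z) -> tau <= s.
  move=> Zj0; have fstc : {within Z j, continuous (fst : R * R -> R)}.
    by apply: continuous_subspaceT => z; exact: cvg_fst.
  have [[tau y]] := compact_EVT_min Zj0 (Zc j) fstc.
  rewrite inE => Zy miny; exists tau; split=> [|s z Zsz]; first by exists y.
  by apply: (miny (s, z)); rewrite inE.
have /choice[tau tauP] : forall j, exists tau : R, Z j !=set0 ->
    (exists y, Z j (tau, y)) /\ forall s z, Z j (s, z) -> tau <= s.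
  move=> j; have [Z0|nZ] := pselect (Z j !=set0); last by exists 0.
  by have [s ss] := min_time j Z0; exists s.
have Zi : `[< Z i !=set0 >].
  by apply/asboolP; exists (t, x); apply/ZP.
case: (@arg_minP _ _ _ _ (fun j => `[< Z j !=set0 >]) tau Zi) => k /asboolP Zk kmin.
have [[y Zy] taumin] := tauP k Zk.
have [tk yk dk] := (ZP _ _ _).1 Zy.
have before s j z : t0 <= s < tau k -> al j <= z <= be j -> 0 < d j s z.
  move=> /andP[s0 sk] zz; rewrite ltNge; apply/negP => dn.
  have sZ : Z j (s, z).
    apply/ZP; split=> //; rewrite s0 (le_trans (ltW sk))//.
    by case/andP: tk.
  have Zj : Z j !=set0 by exists (s, z).
  have := kmin j (asboolT Zj); rewrite leNgt => /negP; apply.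
  by apply: le_lt_trans sk; apply: (tauP j Zj).2 sZ.
have t0k : t0 < tau k.
  have /andP[t0k _] := tk; rewrite lt_neqAle t0k andbT; apply/eqP => e.
  by move: (d0 k y yk); rewrite e ltNge dk.
have ge0 j z : al j <= z <= be j -> 0 <= d j (tau k) z.
  move=> zz; rewrite leNgt; apply/negP => dneg.
  have Aq : (`[t0, t1] `*` `[al j, be j]) (tau k, z).
    by split; rewrite /= in_itv.
  have /subspace_continuousP/(_ _ Aq) := dc j.
  move=> /cvgr_lt/(_ _ dneg); rewrite /= near_withinE => nb.
  have cs : (fun s => (s, z)) @ tau k --> (tau k, z).
    exact: (cvg_pair cvg_id (cvg_cst z)).
  have nb' : \forall s \near (tau k)^'-,
      (`[t0, t1] `*` `[al j, be j]) (s, z) -> d j s z < 0.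
    have nb1 := cs _ nb.
    rewrite near_withinE; near=> s => _.
    by near: s; exact: nb1.
  near (tau k)^'- => s.
  have sk : s < tau k by near: s; exact: nbhs_left_lt.
  have s0 : t0 < s by near: s; exact: nbhs_left_gt.
  have : d j s z < 0.
    suff : (`[t0, t1] `*` `[al j, be j]) (s, z) by near: s.
    split => /=; rewrite in_itv//= (ltW s0) (le_trans (ltW sk))//.
    by case/andP: tk.
  by rewrite ltNge (ltW (before _ _ _ _ _))// (ltW s0).
apply: (nocontact (tau k) k y) => //.
- by rewrite t0k; case/andP: tk.
- by apply/eqP; rewrite eq_le dk ge0.
- by move=> s ss; exact: before.
Unshelve. all: by end_near. Qed.
End Contact.

(** * One-variable calculus: touching functions, one-sided slopes *)

Section Calculus.
Context {R : realType}.
Implicit Types (f g r : R -> R).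

Lemma is_derive_continuous f (x d : R) :
  is_derive x 1 f d -> {for x, continuous f}.
Proof.
move=> fd; apply: differentiable_continuous; apply/derivable1_diffP.
exact: ex_derive.
Qed.

(** The next lemmas are the usual rules for pointwise expressions, with the
value of the derivative left to an equation. *)
Lemma der_comp f g (x a b c : R) : is_derive (g x) 1 f a ->
  is_derive x 1 g b -> c = a * b -> is_derive x 1 (fun y => f (g y)) c.
Proof. by move=> fa gb ->; exact: is_derive1_comp. Qed.

Lemma derD f g (x a b c : R) : is_derive x 1 f a -> is_derive x 1 g b ->
  c = a + b -> is_derive x 1 (fun y => f y + g y) c.
Proof. by move=> fa gb ->; exact: is_deriveD. Qed.

Lemma derN f (x a c : R) : is_derive x 1 f a -> c = - a ->
  is_derive x 1 (fun y => - f y) c.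
Proof. by move=> fa ->; exact: is_deriveN. Qed.

Lemma derB f g (x a b c : R) : is_derive x 1 f a -> is_derive x 1 g b ->
  c = a - b -> is_derive x 1 (fun y => f y - g y) c.
Proof. by move=> fa gb ->; exact: is_deriveB. Qed.

Lemma derM f g (x a b c : R) : is_derive x 1 f a -> is_derive x 1 g b ->
  c = f x * b + g x * a -> is_derive x 1 (fun y => f y * g y) c.
Proof. by move=> fa gb ->; exact: is_deriveM. Qed.

Lemma der_id (x : R) : is_derive x 1 (fun y => y) 1.
Proof. exact: is_derive_id. Qed.

Lemma der_cst (k x : R) : is_derive x 1 (fun _ => k) 0.
Proof. exact: is_derive_cst. Qed.

Lemma der_near f g (x a : R) : is_derive x 1 g a ->
  (\forall y \near x, f y = g y) -> is_derive x 1 f a.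
Proof.
move=> ga fg; apply: near_eq_is_derive ga.
by near=> y; apply/esym; near: y.
Unshelve. all: by end_near. Qed.

Lemma derive_le0_of_left_ge0 g (t d : R) :
  is_derive t 1 g d -> g t = 0 -> (\forall s \near t^'-, 0 <= g s) -> d <= 0.
Proof.
move=> /is_derive1_caratheodory[p [pE pc <-]] gt0 gge0.
rewrite leNgt; apply/negP => pt0.
have pn : \forall s \near t, 0 < p s by move/cvgr_gt : pc; exact.
near t^'- => s.
have st : s < t by near: s; exact: nbhs_left_lt.
have : 0 <= g s by near: s.
have ps : 0 < p s.
  near: s; rewrite near_withinE; near=> s => _.
  by near: s.
have := pE s; rewrite gt0 subr0 => ->.
by rewrite pmulr_rge0// subr_ge0 leNgt st.
Unshelve. all: by end_near. Qed.

Lemma local_min_derive r (x d : R) :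
  is_derive x 1 r d -> r x = 0 -> (\forall y \near x, 0 <= r y) -> d = 0.
Proof.
move=> rd rx rge; apply/eqP; rewrite eq_le; apply/andP; split.
  apply: derive_le0_of_left_ge0 rd rx _.
  by rewrite near_withinE; near=> s => _; near: s.
rewrite -oppr_le0.
have rd' : is_derive (- x) 1 (r \o -%R) (- d).
  apply: der_comp (is_deriveNid _ _) _; first by rewrite opprK; exact: rd.
  by rewrite mulrN1.
apply: derive_le0_of_left_ge0 rd' _ _; first by rewrite /= opprK.
have : \forall y \near - x, 0 <= r (- y).
  have : (- y) @[y --> - x] --> x by rewrite -[X in _ --> X]opprK; exact: cvgN.
  by move=> /(_ _ rge).
by move=> h; rewrite near_withinE; near=> s => _; near: s.
Unshelve. all: by end_near. Qed.

(** The difference [u - S] has a minimum at [x]: if its second derivative were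
negative, its first derivative, which vanishes at [x], would be negative just
to the right of [x], and so would the difference itself. *)
Lemma second_derivative_test (u u1 S S1 : R -> R) (x p q : R) :
  (\forall y \near x, is_derive (y : R) 1 u (u1 y)) -> is_derive x 1 u1 p ->
  (\forall y \near x, is_derive (y : R) 1 S (S1 y)) -> is_derive x 1 S1 q ->
  S x = u x -> (\forall y \near x, S y <= u y) -> q <= p.
Proof.
move=> ud u1d Sd S1d Sux Sle.
pose r y := u y - S y; pose r1 y := u1 y - S1 y.
have rd : \forall y \near x, is_derive (y : R) 1 r (r1 y).
  near=> y.
  have h1 : is_derive y 1 u (u1 y) by near: y.
  have h2 : is_derive y 1 S (S1 y) by near: y.
  exact: is_deriveB.
have rx : r x = 0 by rewrite /r Sux subrr.
have rge : \forall y \near x, 0 <= r y.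
  by near=> y; rewrite /r subr_ge0; near: y.
have r1x : r1 x = 0.
  by have rdx := nbhs_singleton rd; exact: (local_min_derive rdx rx rge).
have r1d : is_derive x 1 r1 (p - q) by exact: is_deriveB.
rewrite -subr_ge0 leNgt; apply/negP => pq.
move/is_derive1_caratheodory : r1d => [k [kE kc kx]].
have kn : \forall s \near x, k s < 0.
  by rewrite -kx in pq; move/cvgr_lt : kc; apply.
have /nbhs_ballP[e /= e0 eb] : \forall y \near x,
    (is_derive (y : R) 1 r (r1 y) /\ 0 <= r y) /\ k y < 0.
  by near=> y; split; [split|]; near: y.
have ball_x y : x <= y < x + e -> ball x e y.
  by move=> ?; rewrite /ball/= ltr_norml; lra.
pose y := x + e / 2.
have xy : x < y by rewrite ltrDl divr_gt0.
have inb c : c \in `[x, y] -> ball x e c.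
  rewrite in_itv/= => /andP[h1 h2]; apply: ball_x; rewrite h1/=.
  by move: h2; rewrite /y; lra.
have [c cxy rcy] : exists2 c, c \in `]x, y[ & r y - r x = r1 c * (y - x).
  apply: MVT => // [z zxy|].
    by have [|[]] := eb z => //; apply: inb; exact: subset_itv_oo_cc zxy.
  apply: continuous_in_subspaceT => z; rewrite inE => zxy.
  have [|[rz _] _] := eb z; first exact: inb.
  exact: is_derive_continuous rz.
have yb : ball x e y by apply: inb; rewrite in_itv/= lexx ltW.
have [[_ ry] _] := eb y yb.
have [_ kc0] := eb c (inb c (subset_itv_oo_cc cxy)).
move: rcy; rewrite rx subr0 => rE; move: ry; rewrite rE.
have := kE c; rewrite r1x subr0 => ->.
move: cxy; rewrite in_itv/= => /andP[xc cy].
rewrite leNgt => /negP; apply.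
by rewrite pmulr_llt0 ?subr_gt0// pmulr_llt0// subr_gt0.
Unshelve. all: by end_near. Qed.

Definition right_slope g (d : R) := (g y - g 0) / y @[y --> 0^'+] --> d.

Lemma right_slope_ge0 g d : right_slope g d -> g 0 = 0 ->
  (\forall y \near 0^'+, 0 <= g y) -> 0 <= d.
Proof.
move=> gd g0 gge; apply: (ler_cvg_to (cvg_cst 0) gd).
near=> y; rewrite g0 subr0 divr_ge0//.
by near: y.
Unshelve. all: by end_near. Qed.

Lemma is_derive_right_slope g d : is_derive (0 : R) 1 g d -> right_slope g d.
Proof.
move=> /is_derive1_caratheodory[p [pE pc pd]]; rewrite /right_slope.
have : p y @[y --> 0^'+] --> d by rewrite -pd; apply: cvg_at_right_filter; exact: pc.
apply: cvg_trans; apply: near_eq_cvg; near=> y.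
have y0 : 0 < y by near: y; exact: nbhs_right_gt.
by rewrite pE subr0 mulfK// gt_eqF.
Unshelve. all: by end_near. Qed.

Lemma right_slopeB g (h : R -> R) (d e : R) : right_slope g d -> right_slope h e ->
  right_slope (fun y => g y - h y) (d - e).
Proof.
move=> gd he; rewrite /right_slope.
have -> : (fun y => (g y - h y - (g 0 - h 0)) / y) =
    (fun y => (g y - g 0) / y - (h y - h 0) / y).
  by apply/funext => y; rewrite -mulrBl; congr (_ / _); ring.
exact: cvgB gd he.
Qed.

Lemma right_slopeZ (c : R) g (d : R) :
  right_slope g d -> right_slope (fun y => c * g y) (c * d).
Proof.
move=> gd; rewrite /right_slope.
have -> : (fun y => (c * g y - c * g 0) / y) = (fun y => c * ((g y - g 0) / y)).
  by apply/funext => y; rewrite -mulrBr mulrA.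
exact: cvgMr.
Qed.

Lemma right_slope_near g (h : R -> R) (d : R) : (\forall y \near 0^'+, g y = h y) ->
  g 0 = h 0 -> right_slope h d -> right_slope g d.
Proof.
move=> gh g0; apply: cvg_trans; apply: near_eq_cvg; near=> y.
by rewrite g0; congr ((_ - _) / _); apply/esym; near: y.
Unshelve. all: by end_near. Qed.

End Calculus.

(** * Primitives of continuous functions *)

Section Primitive.
Context {R : realType}.
Notation mu := (@lebesgue_measure R).

Lemma potential0 (g : R -> R) : potential g 0 = 0.
Proof. by rewrite /potential lexx set_itv1 Rintegral_set1. Qed.

(** On [- M, +oo[ the function [potential g] differs by a constant from the
integral over [- M, s], to which the fundamental theorem applies; [M] is chosen
so that [x] is in the interior. *)
Lemma is_derive_potential (g : R -> R) (x : R) :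
  continuous g -> is_derive x 1 (potential g) (g x).
Proof.
move=> gc; pose M := `|x| + 1.
have M0 : 0 < M by rewrite ltr_wpDl.
have xM : `|x| < M by rewrite ltrDl.
have int (a b : R) : mu.-integrable `[a, b] (EFin \o g).
  apply: continuous_compact_integrable; first exact: segment_compact.
  exact: continuous_subspaceT.
have potE (s : R) : - M < s ->
    potential g s = \int[mu]_(r in `[- M, s]) g r - \int[mu]_(r in `[- M, 0]) g r.
  move=> Ms; rewrite /potential; case: leP => [s0|s0].
    rewrite Rintegral_itvB//= ?bnd_simp// ?oppr_le0 ?ltW//.
    rewrite Rintegral_itv_obnd_cbnd//.
    by apply: integrableS (int 0 s) => //; exact: subset_itv_oc_cc.
  rewrite -[RHS]opprB Rintegral_itvB//= ?bnd_simp// ?ltW//.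
  rewrite Rintegral_itv_obnd_cbnd//.
  by apply: integrableS (int s 0) => //; exact: subset_itv_oc_cc.
have Mx : - M < x by case/ltr_normlP: xM; rewrite ltrNl.
have [|dI Ix] := @continuous_FTC1_closed R g (- M) x (x + 1) _ (int _ _) Mx (gc x).
  by rewrite ltrDl.
apply: (@der_near _ _ (fun s => \int[mu]_(r in `[- M, s]) g r -
   \int[mu]_(r in `[- M, 0]) g r)).
  apply: derB (der_cst _ _) _; last by rewrite subr0; reflexivity.
  apply: DeriveDef; first exact: dI.
  by rewrite -derive1E; exact: Ix.
by near=> s; apply: potE; near: s; exact: lt_nbhsr.
Unshelve. all: by end_near. Qed.

End Primitive.

(** * Ramps *)

Section Ramp.
Context {R : realType}.

Lemma continuous_maxr (T : topologicalType) (f g : T -> R) (x : T) :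
  {for x, continuous f} -> {for x, continuous g} ->
  {for x, continuous (fun y => Num.max (f y) (g y))}.
Proof. exact: continuous_max. Qed.

Lemma continuous_minr (T : topologicalType) (f g : T -> R) (x : T) :
  {for x, continuous f} -> {for x, continuous g} ->
  {for x, continuous (fun y => Num.min (f y) (g y))}.
Proof. exact: continuous_min. Qed.

(** [E] is only used up to its top [d], where it is extended by [th], in the
form [E (Num.min x d)].  It is nevertheless smooth on both sides of [d], which
makes it a test function from below for this extension at the point [d]
itself.  The function [sg] is the inverse of [E]. *)
Record ramp (psi Psi : R -> R) (th d : R) (E E1 sg : R -> R) : Prop := Ramp {
  ramp_d_gt0 : 0 < d;
  ramp_0 : E 0 = 0;
  ramp_d : E d = th;
  ramp_derive : forall x, is_derive (x : R) 1 E (E1 x);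
  ramp_energy : forall x, 0 <= x <= d -> E1 x = Num.sqrt (2 * (Psi th - Psi (E x)));
  ramp_derive2 : forall x, 0 < x <= d -> is_derive (x : R) 1 E1 (- psi (E x));
  ramp_lt : forall x y, x < y -> y <= d -> E x < E y;
  ramp_le : forall x, E x <= th;
  ramp_inv : forall b, b < th -> [/\ sg b < d, E (sg b) = b, 0 < E1 (sg b) &
    is_derive (b : R) 1 sg (E1 (sg b))^-1]
}.

Lemma increasing_of_derive_gt0 (f f1 : R -> R) :
  (forall x, is_derive (x : R) 1 f (f1 x)) -> (forall x, 0 < f1 x) ->
  forall x y, x < y -> f x < f y.
Proof.
move=> fd f1_gt0 x y xy; rewrite -subr_gt0.
have [z _ ->] : exists2 z, z \in `]x, y[ & f y - f x = f1 z * (y - x).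
  apply: MVT => // ; apply: continuous_subspaceT => z.
  exact: is_derive_continuous (fd z).
by rewrite mulr_gt0// subr_gt0.
Qed.

(** [W] solves the autonomous equation W' = k(W), W(0) = 0: it is the inverse of
a primitive of 1 / k, onto because 1 / k is bounded below. *)
Lemma primitive_bijection (k : R -> R) (C : R) : continuous k ->
  (forall z, 0 < k z <= C) ->
  exists T W : R -> R, [/\ T 0 = 0, cancel T W, cancel W T,
    forall z, is_derive (z : R) 1 T (k z)^-1 &
    forall y, is_derive (y : R) 1 W (k (W y))].
Proof.
move=> kc kb; have k0 z : 0 < k z by case/andP: (kb z).
have C0 : 0 < C by case/andP: (kb 0) => h /(lt_le_trans h).
pose T := potential (fun z => (k z)^-1).
have Td z : is_derive (z : R) 1 T (k z)^-1.
  apply: is_derive_potential => y; apply: cvgV; first by rewrite gt_eqF.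
  exact: kc.
have Tlt : forall x y, x < y -> T x < T y.
  by apply: (increasing_of_derive_gt0 Td) => z; rewrite invr_gt0.
have T0 : T 0 = 0 by exact: potential0.
have Tc : continuous T by move=> z; exact: is_derive_continuous (Td z).
have Tgrow x y : x <= y -> (y - x) / C <= T y - T x.
  move=> xy.
  have [|z _ ->] := @MVT_segment R T (fun z => (k z)^-1) x y xy (fun z _ => Td z).
    exact: continuous_subspaceT.
  rewrite mulrC ler_wpM2r// ?subr_ge0// lef_pV2 ?posrE//.
  by case/andP: (kb z).
have Tinj : injective T.
  move=> x y Txy; apply/eqP; rewrite eq_le !leNgt; apply/andP; split;
  by apply/negP => /Tlt; rewrite Txy ltxx.
have Tsurj y : exists z, T z = y.
  pose N := C * `|y|.
  have N0 : 0 <= N by rewrite mulr_ge0// ltW.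
  have h1 : `|y| <= T N.
    have := Tgrow 0 N N0; rewrite T0 !subr0 /N mulrAC divff ?mul1r//.
    by rewrite gt_eqF.
  have h2 : T (- N) <= - `|y|.
    have := Tgrow (- N) 0; rewrite oppr_le0 => /(_ N0).
    rewrite T0 sub0r sub0r opprK /N mulrAC divff ?mul1r ?gt_eqF//.
    by rewrite lerNr.
  have NN : - N <= N by rewrite ge0_cp.
  have [|c _ cE] := @IVT R T (- N) N y NN (continuous_subspaceT Tc).
    rewrite ge_min le_max; apply/andP; split; apply/orP; [left|right].
      by rewrite (le_trans h2)// lerNl ler_normr lexx orbT.
    by rewrite (le_trans _ h1)// ler_norm.
  by exists c.
have /choice[W WK] := Tsurj.
have TK : cancel T W by move=> z; apply: Tinj; rewrite WK.
exists T, W; split => // y.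
rewrite -{1}(WK y) -[k (W y)]invrK; apply: is_derive_inverse.
- by near=> z; rewrite TK.
- by near=> z; exact: Tc.
- by rewrite invr_neq0// gt_eqF.
Unshelve. all: by end_near. Qed.

(** The equation E' = sqrt (2 (Psi(th) - Psi(E))) is singular at E = th.  The
substitution E = th - w^2 removes the singularity: if Psi(th) - Psi(s) =
p(s) (th - s) then w' = - sqrt (p(th - w^2) / 2), whose right side does not
vanish because p(th) = psi(th) > 0.  So [w] passes through 0 at a finite point
[d], with a nonzero speed, and [E] reaches its top there. *)
Lemma ramp_exists (psi Psi : R -> R) (th : R) :
  (forall x, is_derive (x : R) 1 Psi (psi x)) ->
  0 < th -> 0 < psi th -> (forall s : R, 0 <= s < th -> Psi s < Psi th) ->
  exists d E E1 sg, ramp psi Psi th d E E1 sg.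
Proof.
move=> Psid th0 psith Psilt.
have [p [pE pcth pth]] := (is_derive1_caratheodory _ _ _).1 (Psid th).
have Psic : continuous Psi by move=> x; exact: is_derive_continuous (Psid x).
have pc : continuous p.
  move=> s; have [->//|sth] := eqVneq s th.
  have pn : \forall y \near s, (Psi y - Psi th) / (y - th) = p y.
    near=> y; rewrite pE mulfK// subr_eq0; near: y.
    exact: open_neq.
  rewrite /continuous_at (_ : p s = (Psi s - Psi th) / (s - th)); last first.
    by rewrite pE mulfK// subr_eq0.
  apply: (cvg_trans (near_eq_cvg pn)).
  apply: cvgM; first by apply: cvgB; [exact: Psic|exact: cvg_cst].
  apply: cvgV; first by rewrite subr_eq0.
  by apply: cvgB; [exact: cvg_id|exact: cvg_cst].
have p_gt0 (s : R) : 0 <= s <= th -> 0 < p s.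
  move=> /andP[s0]; rewrite le_eqVlt => /predU1P[->|sth]; first by rewrite pth.
  have : p s * (s - th) < 0 by rewrite -pE subr_lt0 Psilt// s0.
  by rewrite nmulr_llt0// subr_lt0.
(* the height [th - z ^+ 2] cut off at 0, where [p] may cease to be positive *)
pose cl (z : R) : R := Num.max (th - z ^+ 2) 0.
have clb z : 0 <= cl z <= th.
  by rewrite /cl le_max lexx orbT/= ge_max (ltW th0) gerBl sqr_ge0.
have clc : continuous cl.
  move=> z; apply: (@continuous_maxr R (fun z => th - z ^+ 2) (fun=> 0)); last exact: cvg_cst.
  by apply: cvgB; [exact: cvg_cst|apply: exprn_continuous].
pose k (z : R) : R := Num.sqrt (p (cl z) / 2).
have kc : continuous k.
  move=> z; apply: (@continuous_comp _ _ _ (fun z => p (cl z) / 2)); last first.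
    exact: sqrt_continuous.
  apply: cvgMl; apply: (@continuous_comp _ _ _ cl p); [exact: clc|exact: pc].
have k_gt0 z : 0 < k z by rewrite sqrtr_gt0 divr_gt0// p_gt0.
have [c0 _ pmax] := EVT_max (ltW th0) (continuous_subspaceT pc).
have kb z : 0 < k z <= Num.sqrt (p c0 / 2).
  rewrite k_gt0 ler_wsqrtr// ler_wpM2r// ?invr_ge0//.
  by apply: pmax; rewrite in_itv/= clb.
have [T [W [T0 TK WK Td Wd]]] := primitive_bijection kc kb.
have Tlt : forall x y, x < y -> T x < T y.
  by apply: (increasing_of_derive_gt0 Td) => z; rewrite invr_gt0.
have Wlt : forall x y, x < y -> W x < W y.
  by apply: (increasing_of_derive_gt0 Wd) => z.
have W0 : W 0 = 0 by rewrite -T0 TK.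
have rth : 0 < Num.sqrt th by rewrite sqrtr_gt0.
pose d := T (Num.sqrt th).
have d0 : 0 < d by rewrite -T0 Tlt.
pose w (x : R) : R := W (d - x).
have wd x : is_derive (x : R) 1 w (- k (w x)).
  apply: (der_comp (Wd _) (derB (der_cst d x) (der_id x) erefl)).
  by rewrite /w; ring.
have wc : continuous w by move=> x; exact: is_derive_continuous (wd x).
pose E (x : R) : R := th - w x ^+ 2.
pose E1 (x : R) : R := 2 * (w x * k (w x)).
have Ed x : is_derive (x : R) 1 E (E1 x).
  apply: (derB (der_cst th x) (derM (wd x) (wd x) erefl)).
  by rewrite /E1; ring.
have w0 : w 0 = Num.sqrt th by rewrite /w subr0 /d TK.
have wdd : w d = 0 by rewrite /w subrr W0.
have wlt x y : x < y -> w y < w x by move=> xy; rewrite /w Wlt// ler_ltB.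
have wle x y : x <= y -> w y <= w x.
  by rewrite le_eqVlt => /predU1P[->//|/wlt/ltW].
have wge0 x : x <= d -> 0 <= w x by rewrite -wdd; exact: wle.
have wgt0 x : x < d -> 0 < w x by rewrite -wdd; exact: wlt.
have Eb x : 0 <= x <= d -> 0 <= E x.
  move=> /andP[x0 xd]; rewrite subr_ge0 -(sqr_sqrtr (ltW th0)) -w0.
  by rewrite ler_sqr ?nnegrE ?wge0 ?(ltW d0)// wle.
have clE x : 0 <= x <= d -> cl (w x) = E x.
  by move=> xd; rewrite /cl max_l// Eb.
have gap x : Psi th - Psi (E x) = p (E x) * w x ^+ 2.
  by rewrite -opprB pE /E; ring.
have E1E x : 0 <= x <= d -> E1 x = Num.sqrt (2 * (Psi th - Psi (E x))).
  move=> xd; have /andP[_ xd'] := xd.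
  have wx0 : 0 <= w x by exact: wge0.
  have pEx : 0 < p (E x) by rewrite p_gt0// Eb//= gerBl sqr_ge0.
  have E10 : 0 <= E1 x by rewrite /E1 mulr_ge0// mulr_ge0// ltW.
  rewrite -[LHS](ger0_norm E10) -sqrtr_sqr; congr Num.sqrt.
  rewrite gap /E1 /k exprMn exprMn sqr_sqrtr clE//; last first.
    by rewrite ltW// divr_gt0.
  by field.
exists d, E, E1, (fun b => d - T (Num.sqrt (th - b))); constructor.
- exact: d0.
- by rewrite /E w0 sqr_sqrtr ?subrr// ltW.
- by rewrite /E wdd expr0n subr0.
- exact: Ed.
- exact: E1E.
- move=> x /andP[x0]; rewrite le_eqVlt => /predU1P[->|xd].
    (* at the top [w] vanishes, so that [w * k w] is differentiable there
       although [k] is only known to be continuous *)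
    have [q [qE qc qd]] := (is_derive1_caratheodory _ _ _).1 (wd d).
    apply/is_derive1_caratheodory.
    exists (fun y => 2 * (q y * k (w y))); split.
    + by move=> z; have := qE z; rewrite /E1 wdd subr0 => ->; ring.
    + apply: cvgMr; apply: cvgM; first exact: qc.
      apply: (@continuous_comp _ _ _ w k); [exact: wc|exact: kc].
    + rewrite qd wdd /E wdd expr0n subr0 mulNr mulrN -expr2 /k sqr_sqrtr.
        by rewrite /cl expr0n subr0 max_l ?(ltW th0)// pth; congr (- _); field.
      by rewrite ltW// divr_gt0// p_gt0.
  have xd' : 0 <= x <= d by rewrite !ltW.
  have G0 : 0 < 2 * (Psi th - Psi (E x)).
    rewrite mulr_gt0// subr_gt0 Psilt// Eb//= gtrBl exprn_gt0//.
    exact: wgt0.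
  apply: (@der_near _ _ (fun y => Num.sqrt (2 * (Psi th - Psi (E y))))); last first.
    near=> y; apply: E1E; apply/andP; split; apply: ltW; near: y.
      exact: lt_nbhsr.
    exact: lt_nbhsl.
  have Gd : is_derive (x : R) 1 (fun y => 2 * (Psi th - Psi (E y)))
      (- (2 * (psi (E x) * E1 x))).
    apply: (derM (der_cst 2 x)
      (derB (der_cst (Psi th) x) (der_comp (Psid _) (Ed x) erefl) erefl)).
    by ring.
  apply: (@der_comp _ _ (fun y => 2 * (Psi th - Psi (E y))) _ _ _ _
    (is_derive1_sqrt G0) Gd).
  rewrite -(E1E _ xd').
  have : E1 x != 0 by rewrite E1E// gt_eqF// sqrtr_gt0.
  by move=> ?; field.
- move=> x y xy yd; rewrite /E ler_ltB// ltr_sqr ?nnegrE ?wlt ?wge0//.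
  by rewrite (le_trans (ltW xy)).
- by move=> x; rewrite /E gerBl; exact: sqr_ge0.
- move=> b bth.
  have rb : 0 < th - b by rewrite subr_gt0.
  have sb : 0 < Num.sqrt (th - b) by rewrite sqrtr_gt0.
  have wsg : w (d - T (Num.sqrt (th - b))) = Num.sqrt (th - b).
    by rewrite /w subKr TK.
  split.
  + by rewrite gtrBl -T0 Tlt.
  + by rewrite /E wsg sqr_sqrtr ?subKr// ltW.
  + by rewrite /E1 wsg mulr_gt0// mulr_gt0.
  + have rd := @der_comp _ _ (fun y => th - y) b _ _ _ (is_derive1_sqrt rb)
      (derB (der_cst th b) (der_id b) erefl) erefl.
    apply: (derB (der_cst d b)
      (@der_comp _ _ (fun y => Num.sqrt (th - y)) b _ _ _ (Td _) rd erefl)).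
    rewrite /E1 wsg; have := k_gt0 (Num.sqrt (th - b)) => kk.
    by field; rewrite !gt_eqF.
Unshelve. all: by end_near. Qed.

End Ramp.

(** * Solutions on an interval, test functions and comparison *)

Section ReactionDiffusion.
Context {R : realType}.
Implicit Types (f : R -> R) (v : R -> R -> R).

(** The equation is read on one interval of the space variable, without any
boundary condition: this is what an edge, or a part of an edge measured from
one of its ends, contributes. *)
Record rd_solution f v (al be : R) : Prop := RdSolution {
  rd_continuous : {within [set z : R * R | al <= z.2 <= be],
    continuous (fun z : R * R => v z.1 z.2)};
  rd_equation : forall t, exists vx : R -> R,
    (forall y, al < y < be -> is_derive (y : R) 1 (v t) (vx y)) /\
    forall x, al < x < be -> exists vxx : R, is_derive (x : R) 1 vx vxx /\
      is_derive (t : R) 1 (v ^~ x) (vxx + f (v t x))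
}.

Lemma rd_solution_sub f v (al be al' be' : R) : al <= al' -> be' <= be ->
  rd_solution f v al be -> rd_solution f v al' be'.
Proof.
move=> ala beb [vc ve]; split.
  apply: continuous_subspaceW vc => z /= /andP[h1 h2].
  by rewrite (le_trans ala h1) (le_trans h2 beb).
move=> t; have [vx [vxd vxx]] := ve t; exists vx.
have sub x : al' < x < be' -> al < x < be.
  by move=> /andP[h1 h2]; rewrite (le_lt_trans ala h1) (lt_le_trans h2 beb).
by split=> [y /sub/vxd|x /sub/vxx].
Qed.

Lemma rd_solution_reflect f v (L : R) : rd_solution f v 0 L ->
  rd_solution f (fun t x => v t (L - x)) 0 L.
Proof.
move=> [vc ve].
have inL x : 0 < x < L -> 0 < L - x < L.
  by move=> ?; lra.
split.
  pose A := [set z : R * R | 0 <= z.2 <= L].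
  pose h (z : R * R) : R * R := (z.1, L - z.2).
  have hc : continuous h.
    move=> [z1 z2].
    have h2 : L - w.2 @[w --> (z1, z2)] --> L - z2.
      by apply: cvgB; [exact: cvg_cst|exact: cvg_snd].
    exact: (cvg_pair cvg_fst h2).
  apply/subspace_continuousP => z Az.
  have Ah w : A w -> A (h w) by rewrite /A/= => ?; lra.
  have /subspace_continuousP/(_ (h z) (Ah z Az)) vh := vc.
  move=> B /vh; rewrite /= !nbhs_simpl /within /= => nB.
  have hn := hc z _ nB; near=> w => Aw.
  suff : A (h w) -> B (v (h w).1 (h w).2) by apply; exact: Ah.
  by near: w; exact: hn.
move=> t; have [vx [vxd vxx]] := ve t.
exists (fun x => - vx (L - x)); split=> [y /inL yL|x /inL xL].
  apply: (@der_comp _ (v t) (fun y => L - y) y _ _ _ (vxd _ yL)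
    (derB (der_cst L y) (der_id y) erefl)).
  by ring.
have [w [wd wt]] := vxx _ xL; exists w; split => //.
apply: (derN (@der_comp _ vx (fun y => L - y) x _ _ _ wd
    (derB (der_cst L x) (der_id x) erefl) erefl)).
by ring.
Unshelve. all: by end_near. Qed.

(** Separate test functions in space and in time suffice, and the one in time is
only compared with the solution before [t]; this is all that a first contact
gives. *)
Lemma touch_from_below f v (al be t x : R) (P P1 th : R -> R) (q r : R) :
  rd_solution f v al be -> al < x < be ->
  (\forall y \near x, is_derive (y : R) 1 P (P1 y)) -> is_derive x 1 P1 q ->
  P x = v t x -> (\forall y \near x, P y <= v t y) ->
  is_derive t 1 th r -> th t = v t x -> (\forall s \near t^'-, th s <= v s x) ->
  q + f (v t x) <= r.
Proof.
move=> [_ ve] xab Pd P1d Px Ple thd tht thle.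
have [vx [vxd vxx]] := ve t; have [w [wd wt]] := vxx _ xab.
have /andP[xa xb] := xab.
have qw : q <= w.
  apply: (@second_derivative_test _ (v t) vx P P1 x) => //.
  near=> y; apply: vxd; apply/andP; split; near: y.
    exact: lt_nbhsr.
  exact: lt_nbhsl.
have : w + f (v t x) - r <= 0.
  have gd := derB wt thd erefl.
  apply: (derive_le0_of_left_ge0 gd); first by rewrite tht subrr.
  by near=> s; rewrite subr_ge0; near: s.
by rewrite subr_le0; apply: le_trans; rewrite lerD2r.
Unshelve. all: by end_near. Qed.

Lemma touch_from_above f v (al be t x : R) (P P1 th : R -> R) (q r : R) :
  rd_solution f v al be -> al < x < be ->
  (\forall y \near x, is_derive (y : R) 1 P (P1 y)) -> is_derive x 1 P1 q ->
  P x = v t x -> (\forall y \near x, v t y <= P y) ->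
  is_derive t 1 th r -> th t = v t x -> (\forall s \near t^'-, v s x <= th s) ->
  r <= q + f (v t x).
Proof.
move=> [_ ve] xab Pd P1d Px Ple thd tht thle.
have [vx [vxd vxx]] := ve t; have [w [wd wt]] := vxx _ xab.
have /andP[xa xb] := xab.
have qw : w <= q.
  apply: (@second_derivative_test _ P P1 (v t) vx x) => //.
  near=> y; apply: vxd; apply/andP; split; near: y.
    exact: lt_nbhsr.
  exact: lt_nbhsl.
have : r - (w + f (v t x)) <= 0.
  have gd := derB thd wt erefl.
  apply: (derive_le0_of_left_ge0 gd); first by rewrite tht subrr.
  by near=> s; rewrite subr_ge0; near: s.
by rewrite subr_le0 => h; apply: le_trans h _; rewrite lerD2r.
Unshelve. all: by end_near. Qed.

Lemma rd_sub_continuous f v (al be t0 t1 : R) (S : R * R -> R) :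
  rd_solution f v al be -> continuous S ->
  {within `[t0, t1] `*` `[al, be], continuous (fun z => v z.1 z.2 - S z)}.
Proof.
move=> [vc _] Sc z.
have vc' : {within `[t0, t1] `*` `[al, be], continuous (fun z => v z.1 z.2)}.
  by apply: continuous_subspaceW vc => w [_] /=; rewrite in_itv.
have Sc' : {within `[t0, t1] `*` `[al, be], continuous S} by exact: continuous_subspaceT.
apply: cvgB; first exact: (vc' z).
exact: (Sc' z).
Qed.

Lemma sub_rd_continuous f v (al be t0 t1 : R) (S : R * R -> R) :
  rd_solution f v al be -> continuous S ->
  {within `[t0, t1] `*` `[al, be], continuous (fun z => S z - v z.1 z.2)}.
Proof.
move=> [vc _] Sc z.
have vc' : {within `[t0, t1] `*` `[al, be], continuous (fun z => v z.1 z.2)}.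
  by apply: continuous_subspaceW vc => w [_] /=; rewrite in_itv.
have Sc' : {within `[t0, t1] `*` `[al, be], continuous S} by exact: continuous_subspaceT.
apply: cvgB; last exact: (vc' z).
exact: (Sc' z).
Qed.

End ReactionDiffusion.

Section Comparison.
Context {R : realType}.
Implicit Types (f : R -> R) (S v : R -> R -> R).

(** Strict subsolutions in the sense of test functions (viscosity subsolutions):
[S] itself need not be differentiable. *)
Definition strict_subsolution_at f S (t x : R) : Prop :=
  exists (P P1 th : R -> R) (q r : R),
    [/\ (\forall y \near x, is_derive (y : R) 1 P (P1 y)) /\ is_derive x 1 P1 q,
        P x = S t x /\ (\forall y \near x, P y <= S t y),
        is_derive t 1 th r,
        th t = S t x /\ (\forall s \near t^'-, th s <= S s x) &
        r < q + f (S t x)].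

Definition strict_supersolution_at f S (t x : R) : Prop :=
  exists (P P1 th : R -> R) (q r : R),
    [/\ (\forall y \near x, is_derive (y : R) 1 P (P1 y)) /\ is_derive x 1 P1 q,
        P x = S t x /\ (\forall y \near x, S t y <= P y),
        is_derive t 1 th r,
        th t = S t x /\ (\forall s \near t^'-, S s x <= th s) &
        q + f (S t x) < r].

(** The hypothesis at a contact is where boundary and vertex conditions enter:
they have to show that the contact point is interior.  The predicate [D]
selects the intervals, e.g. the edges at one vertex. *)
Lemma comparison_below (I : finType) (D : pred I) f (v S : I -> R -> R -> R)
    (al be : I -> R) (T t : R) :
  (forall i, D i -> rd_solution f (v i) (al i) (be i)) ->
  (forall i, D i -> continuous (fun z : R * R => S i z.1 z.2)) ->
  (forall i x, D i -> al i <= x <= be i -> S i T x < v i T x) ->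
  (forall s i x, D i -> T < s <= t -> al i <= x <= be i -> v i s x = S i s x ->
     (forall j y, D j -> al j <= y <= be j -> S j s y <= v j s y) ->
     al i < x < be i /\ strict_subsolution_at f (S i) s x) ->
  forall s i x, D i -> T <= s <= t -> al i <= x <= be i -> S i s x < v i s x.
Proof.
move=> vs Sc init touch s i x Di sT xb; rewrite -subr_gt0.
pose d i s x : R := if D i then v i s x - S i s x else 1.
suff : 0 < d i s x by rewrite /d Di.
move: s i x sT xb {Di}; apply: first_contact.
- move=> i; rewrite /d; case Di : (D i).
    exact: rd_sub_continuous (vs i Di) (Sc i Di).
  by apply: continuous_subspaceT => z; exact: cvg_cst.
- by move=> i x xb; rewrite /d; case: ifPn => // Di; rewrite subr_gt0 init.
- move=> s i x sT xb; rewrite /d; case: ifPn => [Di|_ /eqP]; last first.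
    by rewrite oner_eq0.
  move=> contact dge0 dbefore.
  have vS : v i s x = S i s x by apply/eqP; rewrite -subr_eq0 contact.
  have Sv j y : D j -> al j <= y <= be j -> S j s y <= v j s y.
    by move=> Dj /dge0; rewrite Dj subr_ge0.
  have [xin [P [P1 [th [q [r [[Pd P1d] [Px PS] thd [tht thS] rq]]]]]]] :=
    touch s i x Di sT xb vS Sv.
  have /andP[xl xr] := xin.
  have /andP[sT0 _] := sT.
  suff : q + f (v i s x) <= r by rewrite leNgt vS rq.
  apply: (touch_from_below (vs i Di) xin Pd P1d _ _ thd).
  + by rewrite Px.
  + near=> y; apply: (@le_trans _ _ (S i s y)); first by near: y.
    apply: Sv => //; apply/andP; split; apply: ltW; near: y.
      exact: lt_nbhsr.
    exact: lt_nbhsl.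
  + by rewrite tht.
  + near=> s'; apply: (@le_trans _ _ (S i s' x)); first by near: s'.
    rewrite -subr_ge0 ltW//; apply: dbefore; apply/andP; split; near: s'.
      by apply: nbhs_left_ge.
    exact: nbhs_left_lt.
Unshelve. all: by end_near. Qed.

Lemma comparison_above (I : finType) (D : pred I) f (v S : I -> R -> R -> R)
    (al be : I -> R) (T t : R) :
  (forall i, D i -> rd_solution f (v i) (al i) (be i)) ->
  (forall i, D i -> continuous (fun z : R * R => S i z.1 z.2)) ->
  (forall i x, D i -> al i <= x <= be i -> v i T x < S i T x) ->
  (forall s i x, D i -> T < s <= t -> al i <= x <= be i -> v i s x = S i s x ->
     (forall j y, D j -> al j <= y <= be j -> v j s y <= S j s y) ->
     al i < x < be i /\ strict_supersolution_at f (S i) s x) ->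
  forall s i x, D i -> T <= s <= t -> al i <= x <= be i -> v i s x < S i s x.
Proof.
move=> vs Sc init touch s i x Di sT xb; rewrite -subr_gt0.
pose d i s x : R := if D i then S i s x - v i s x else 1.
suff : 0 < d i s x by rewrite /d Di.
move: s i x sT xb {Di}; apply: first_contact.
- move=> i; rewrite /d; case Di : (D i).
    exact: sub_rd_continuous (vs i Di) (Sc i Di).
  by apply: continuous_subspaceT => z; exact: cvg_cst.
- by move=> i x xb; rewrite /d; case: ifPn => // Di; rewrite subr_gt0 init.
- move=> s i x sT xb; rewrite /d; case: ifPn => [Di|_ /eqP]; last first.
    by rewrite oner_eq0.
  move=> contact dge0 dbefore.
  have vS : v i s x = S i s x by apply/esym/eqP; rewrite -subr_eq0 contact.
  have Sv j y : D j -> al j <= y <= be j -> v j s y <= S j s y.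
    by move=> Dj /dge0; rewrite Dj subr_ge0.
  have [xin [P [P1 [th [q [r [[Pd P1d] [Px PS] thd [tht thS] rq]]]]]]] :=
    touch s i x Di sT xb vS Sv.
  have /andP[xl xr] := xin.
  have /andP[sT0 _] := sT.
  suff : r <= q + f (v i s x) by rewrite leNgt vS rq.
  apply: (touch_from_above (vs i Di) xin Pd P1d _ _ thd).
  + by rewrite Px.
  + near=> y; apply: (@le_trans _ _ (S i s y)); last by near: y.
    apply: Sv => //; apply/andP; split; apply: ltW; near: y.
      exact: lt_nbhsr.
    exact: lt_nbhsl.
  + by rewrite tht.
  + near=> s'; apply: (@le_trans _ _ (S i s' x)); last by near: s'.
    rewrite -subr_ge0 ltW//; apply: dbefore; apply/andP; split; near: s'.
      by apply: nbhs_left_ge.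
    exact: nbhs_left_lt.
Unshelve. all: by end_near. Qed.
End Comparison.

(** * Comparison on a single edge *)

Section SingleEdge.
Context {R : realType}.

(** A downward parabola centred at [x0] that starts at height [th] and rises
slowly to [q]: it exceeds [th] only where the reaction is positive, and only
well inside the interval. *)
Lemma raise_lower_bound (f : R -> R) (th q : R) : continuous f -> th < q ->
  (forall s, th <= s <= q -> 0 < f s) ->
  exists rho tau : R, [/\ 0 < rho, 0 < tau &
    forall (v : R -> R -> R) (x0 T : R),
      rd_solution f v (x0 - rho) (x0 + rho) ->
      (forall t x, T <= t -> x0 - rho <= x <= x0 + rho -> th < v t x) ->
      forall t, T + tau <= t -> q < v t x0].
Proof.
move=> fc thq f_gt0.
have [m0 m0b mmin] := EVT_min (ltW thq) (continuous_subspaceT fc).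
have mu0 : 0 < f m0 by apply: f_gt0; move: m0b; rewrite in_itv.
(* curvature and rising speed are both [e], with [2 * e + e < f m0]; the
   parabola of height [q - th] then has half-width [rho] *)
pose e := f m0 / 4; pose tau := (q - th) / e; pose rho := Num.sqrt tau.
have e0 : 0 < e by rewrite divr_gt0.
have tau0 : 0 < tau by rewrite divr_gt0// subr_gt0.
have rho0 : 0 < rho by rewrite sqrtr_gt0.
have rho2 : e * rho ^+ 2 = q - th.
  by rewrite sqr_sqrtr ?(ltW tau0)// /tau mulrC divfK// gt_eqF.
have etau : e * tau = q - th by rewrite /tau mulrC divfK// gt_eqF.
exists rho, tau; split => // v x0 T vs vth t Tt.
pose S (s x : R) := q + e * (s - t) - e * (x - x0) ^+ 2.
have Sc : continuous (fun z : R * R => S z.1 z.2).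
  move=> z; apply: cvgB.
    apply: cvgD; first exact: cvg_cst.
    by apply: cvgMr; apply: cvgB; [exact: cvg_fst|exact: cvg_cst].
  apply: cvgMr; apply: (@continuous_comp _ _ _ (fun z : R * R => z.2 - x0) (fun y => y ^+ 2)).
    by apply: cvgB; [exact: cvg_snd|exact: cvg_cst].
  exact: exprn_continuous.
suff : S t x0 < v t x0 by rewrite /S !subrr expr0n mulr0 addr0 subr0.
apply: (@comparison_below R unit xpredT f (fun=> v) (fun=> S) (fun=> x0 - rho)
  (fun=> x0 + rho) (t - tau) t _ _ _ _ t tt x0) => //.
- move=> _ x _ xb; apply: le_lt_trans (vth _ _ _ xb); last by lra.
  have ex := mulr_ge0 (ltW e0) (sqr_ge0 (x - x0)).
  have -> : S (t - tau) x = q - e * tau - e * (x - x0) ^+ 2 by rewrite /S; ring.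
  by lra.
- move=> s _ x _ /andP[st1 st2] xb vS _.
  have vth' : th < S s x by rewrite -vS; apply: vth => //; lra.
  have es : e * (s - t) <= 0 by rewrite mulr_ge0_le0 ?subr_le0// ltW.
  have ex := mulr_ge0 (ltW e0) (sqr_ge0 (x - x0)).
  have vq : S s x <= q by rewrite /S; lra.
  split.
    have : `|x - x0| < rho.
      rewrite -(ger0_norm (ltW rho0)) -ltr_sqr ?nnegrE// !real_normK ?num_real//.
      by rewrite -(ltr_pM2l e0) rho2; move: vth'; rewrite /S; lra.
    by rewrite ltr_norml; lra.
  exists (S s), (fun y => - (2 * e * (y - x0))), (fun s => S s x), (- (2 * e)), e.
  split.
  + split; first near=> y.
      have h := derB (der_id y) (der_cst x0 y) erefl.
      apply: (derB (der_cst (q + e * (s - t)) y)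
        (derM (der_cst e y) (derM h h erefl) erefl)).
      by ring.
    apply: (derN (derM (der_cst (2 * e) x) (derB (der_id x) (der_cst x0 x) erefl) erefl)).
    by ring.
  + by split => //; near=> y.
  + apply: (derB (derD (der_cst q s) (derM (der_cst e s)
        (derB (der_id s) (der_cst t s) erefl) erefl) erefl) (der_cst _ s)).
    by ring.
  + by split => //; near=> y.
  + have fx : f m0 <= f (S s x) by apply: mmin; rewrite in_itv/= vq ltW.
    by move: e0 fx; rewrite /e; lra.
- by lra.
- by lra.
Unshelve. all: by end_near. Qed.

Lemma ramp_plateau psi Psi (th d : R) E E1 sg (z : R) :
  ramp psi Psi th d E E1 sg -> E z <= E (Num.min z d).
Proof.
move=> rE; rewrite /Num.min; case: ifP => // _.
by rewrite (ramp_d rE) (ramp_le rE).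
Qed.

Lemma ramp_gt0 psi Psi (th d : R) E E1 sg (z : R) :
  ramp psi Psi th d E E1 sg -> 0 < E (Num.min z d) -> 0 < z.
Proof.
move=> rE; apply: contraTT; rewrite -!leNgt => z0.
have d0 := ramp_d_gt0 rE.
rewrite min_l; last by rewrite (le_trans z0)// ltW.
move: z0; rewrite le_eqVlt => /predU1P[->|z0]; first by rewrite (ramp_0 rE).
by rewrite -(ramp_0 rE) ltW// (ramp_lt rE)// ltW.
Qed.

Lemma ramp_min_le0 psi Psi (th d : R) E E1 sg (z : R) :
  ramp psi Psi th d E E1 sg -> z <= 0 -> E (Num.min z d) <= 0.
Proof.
move=> rE z0; rewrite leNgt; apply/negP => /(ramp_gt0 rE).
by rewrite ltNge z0.
Qed.

Lemma ramp_continuous psi Psi (th d : R) E E1 sg :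
  ramp psi Psi th d E E1 sg -> continuous E.
Proof. by move=> rE x; exact: is_derive_continuous (ramp_derive rE x). Qed.

(** A stationary subsolution with compact support: a ramp up and its mirror image,
separated by a plateau of width 2. *)
Lemma bump_persists (f psi Psi : R -> R) (th d : R) E E1 sg v (X T : R) :
  ramp psi Psi th d E E1 sg -> (forall s, psi s < f s) -> 0 < f th ->
  rd_solution f v X (X + 2 * d + 2) ->
  (forall t x, T <= t -> X <= x <= X + 2 * d + 2 -> 0 < v t x) ->
  (forall x, X <= x <= X + 2 * d + 2 -> th < v T x) ->
  forall t, T <= t -> th < v t (X + d + 1).
Proof.
move=> rE psif fth vs v0 vT t Tt.
have d0 := ramp_d_gt0 rE.
pose m (x : R) := Num.min (x - X) (X + 2 * d + 2 - x).
pose S (x : R) := E (Num.min (m x) d).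
have Sle x : S x <= th by exact: (ramp_le rE).
have mc : continuous m.
  move=> x; apply: (@continuous_minr R R (fun x => x - X) (fun x => X + 2 * d + 2 - x)).
    by apply: cvgB; [exact: cvg_id|exact: cvg_cst].
  by apply: cvgB; [exact: cvg_cst|exact: cvg_id].
have Sc : continuous (fun z : R * R => S z.2).
  move=> z; apply: (@continuous_comp _ _ _ snd S); first exact: cvg_snd.
  apply: (@continuous_comp _ _ _ (fun x => Num.min (m x) d) E); last exact: (ramp_continuous rE).
  apply: (@continuous_minr R R m (fun=> d)); first exact: mc.
  exact: cvg_cst.
have mid : S (X + d + 1) = th.
  rewrite /S [X in E X](_ : _ = d) ?(ramp_d rE)// min_r// /m le_min; lra.
suff : S (X + d + 1) < v t (X + d + 1) by rewrite mid.
apply: (@comparison_below R unit xpredT f (fun=> v) (fun _ _ x => S x) (fun=> X)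
  (fun=> X + 2 * d + 2) T t _ _ _ _ t tt); rewrite ?Tt ?lexx//; last by lra.
- by move=> _ x _ xb; rewrite (le_lt_trans (Sle x))// vT.
- move=> s _ x _ /andP[sT st] xb vS _.
  have mx0 : 0 < m x by apply: (ramp_gt0 rE); rewrite -/(S x) -vS v0// ltW.
  have /andP[xl xr] : X < x < X + 2 * d + 2.
    by move: mx0; rewrite /m lt_min !subr_gt0.
  split; first by rewrite xl.
  have touch (P P1 : R -> R) q : (forall y, is_derive (y : R) 1 P (P1 y)) ->
      is_derive x 1 P1 q -> P x = S x -> (\forall y \near x, P y <= S y) ->
      0 < q + f (S x) -> strict_subsolution_at f (fun _ x => S x) s x.
    move=> Pd P1d Px PS q0; exists P, P1, (fun=> S x), q, 0; split => //.
    + by split => //; near=> y; exact: Pd.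
    + exact: der_cst.
    + by split => //; near=> y.
  have [xd|xd] := leP (x - X) d.
    have mE : m x = x - X by rewrite /m min_l//; lra.
    have xE : S x = E (x - X) by rewrite /S mE min_l.
    have sd y := derB (der_id y) (der_cst X y) erefl.
    apply: (touch (fun y => E (y - X)) (fun y => E1 (y - X)) (- psi (S x))) => //.
    + move=> y.
      apply: (@der_comp _ E (fun y => y - X) _ _ _ _ (ramp_derive rE _) (sd y)).
      by rewrite subr0 mulr1.
    + rewrite xE.
      apply: (@der_comp _ E1 (fun y => y - X) _ _ _ _ (ramp_derive2 rE _) (sd x)).
        by rewrite xd subr_gt0 xl.
      by rewrite subr0 mulr1.
    + near=> y; rewrite /S /m [X in E (Num.min X _)]min_l; first exact: (ramp_plateau _ rE).
      suff : y < X + d + 1 by lra.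
      by near: y; apply: lt_nbhsl; lra.
    + by rewrite addrC subr_gt0.
  have [xd'|xd'] := leP (X + 2 * d + 2 - x) d.
    have mE : m x = X + 2 * d + 2 - x by rewrite /m min_r//; lra.
    have xE : S x = E (X + 2 * d + 2 - x) by rewrite /S mE min_l.
    have sd y := derB (der_cst (X + 2 * d + 2) y) (der_id y) erefl.
    apply: (touch (fun y => E (X + 2 * d + 2 - y))
      (fun y => - E1 (X + 2 * d + 2 - y)) (- psi (S x))) => //.
    + move=> y.
      apply: (@der_comp _ E (fun y => X + 2 * d + 2 - y) _ _ _ _ (ramp_derive rE _) (sd y)).
      by rewrite sub0r mulrN1.
    + rewrite xE.
      apply: (derN (@der_comp _ E1 (fun y => X + 2 * d + 2 - y) _ _ _ _
        (ramp_derive2 rE _) (sd x) erefl)).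
        by rewrite xd' subr_gt0 xr.
      by rewrite sub0r mulrN1 opprK.
    + near=> y; rewrite /S /m [X in E (Num.min X _)]min_r; first exact: (ramp_plateau _ rE).
      suff : X + d + 1 < y by lra.
      by near: y; apply: lt_nbhsr; lra.
    + by rewrite addrC subr_gt0.
  have SE : \forall y \near x, S y = th.
    near=> y; rewrite /S min_r ?(ramp_d rE)// /m le_min; apply/andP; split.
      suff : X + d < y by lra.
      by near: y; apply: lt_nbhsr; lra.
    suff : y < X + d + 2 by lra.
    by near: y; apply: lt_nbhsl; lra.
  have Sx : S x = th by exact: nbhs_singleton SE.
  apply: (touch (fun=> th) (fun=> 0) 0) => //.
  + near=> y; suff -> : S y = th by [].
    by near: y; exact: SE.
  + by rewrite Sx add0r.
Unshelve. all: by end_near. Qed.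

(** The sum of the two exponentials solves z_t = z_xx - kap z and dominates [v]
at x = 0 and at t = T.  The added multiple of y^2 + 2 (s - T) dominates [v] at
infinity and makes the supersolution strict. *)
Lemma exponential_decay (f : R -> R) (kap m T : R) (v : R -> R -> R) :
  0 < kap -> 0 < m -> (forall s, 0 <= s <= m -> f s <= - (kap * s)) ->
  (forall X, rd_solution f v 0 X) ->
  (forall t x, T <= t -> 0 <= x -> 0 < v t x <= m) ->
  forall t x, T <= t -> 0 <= x ->
    v t x <= m * expR (- (Num.sqrt kap * x)) + m * expR (- (kap * (t - T))).
Proof.
move=> kap0 m0 fle vs vb t x Tt x0.
apply/ler_addgt0Pr => eps eps0.
pose r := Num.sqrt kap.
have r2 : r * r = kap by rewrite -expr2 sqr_sqrtr// ltW.
have w0 : 0 < x ^+ 2 + 2 * (t - T) + 1.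
  by rewrite ltr_wpDl// addr_ge0 ?sqr_ge0// mulr_ge0// subr_ge0.
pose del := eps / (x ^+ 2 + 2 * (t - T) + 1).
have del0 : 0 < del by rewrite divr_gt0.
pose S (s y : R) := m * expR (- (r * y)) + m * expR (- (kap * (s - T)))
  + del * (y ^+ 2 + 2 * (s - T)).
suff : v t x < S t x.
  move=> /ltW/le_trans; apply; rewrite lerD2l /del mulrC mulrA.
  rewrite ler_pdivrMr// mulrC ler_pM2l//; lra.
have Sc : continuous (fun z : R * R => S z.1 z.2).
  have fstc (z : R * R) : z.1 @[z --> z] --> z.1 by exact: cvg_fst.
  have sndc (z : R * R) : z.2 @[z --> z] --> z.2 by exact: cvg_snd.
  move=> z; apply: cvgD; first apply: cvgD.
  - apply: cvgMr; apply: (@continuous_comp _ _ _ (fun z : R * R => - (r * z.2)) expR).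
      by apply: cvgN; apply: cvgMr; exact: sndc.
    exact: continuous_expR.
  - apply: cvgMr; apply: (@continuous_comp _ _ _ (fun z : R * R => - (kap * (z.1 - T))) expR).
      by apply: cvgN; apply: cvgMr; apply: cvgB; [exact: fstc|exact: cvg_cst].
    exact: continuous_expR.
  - apply: cvgMr; apply: cvgD.
      apply: (@continuous_comp _ _ _ (fun w : R * R => w.2) (fun y : R => y ^+ 2)); first exact: sndc.
      exact: exprn_continuous.
    by apply: cvgMr; apply: cvgB; [exact: fstc|exact: cvg_cst].
pose X := x + 1 + m / del.
have mdel : 0 < m / del by rewrite divr_gt0.
have e1 y : 0 < m * expR (- (r * y)) by rewrite mulr_gt0// expR_gt0.
have e2 s : 0 < m * expR (- (kap * (s - T))) by rewrite mulr_gt0// expR_gt0.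
have w_ge0 s y : T <= s -> 0 <= del * (y ^+ 2 + 2 * (s - T)).
  move=> Ts; apply: mulr_ge0; first exact: ltW.
  by rewrite addr_ge0 ?sqr_ge0// mulr_ge0// subr_ge0.
apply: (@comparison_above R unit xpredT f (fun=> v) (fun=> S) (fun=> 0)
  (fun=> X) T t _ _ _ _ t tt); rewrite ?Tt ?lexx ?x0//.
- move=> _ y _ /andP[y0 _]; have /andP[_ vm] := vb T y (lexx _) y0.
  apply: (le_lt_trans vm); rewrite /S subrr mulr0 oppr0 expR0 mulr1.
  have := e1 y; have := w_ge0 T y (lexx _); rewrite subrr; lra.
- move=> s _ y _ /andP[Ts st] /andP[y0 yX] vS _.
  have /andP[vg vm] := vb s y (ltW Ts) y0.
  have y_gt0 : 0 < y.
    rewrite lt_neqAle y0 andbT; apply/eqP => y00.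
    move: vm; rewrite vS /S -y00 mulr0 oppr0 expR0 mulr1.
    by have := e2 s; have := w_ge0 s 0 (ltW Ts); lra.
  have ddy2 : 0 < del * y ^+ 2 by rewrite mulr_gt0// exprn_gt0.
  split.
    rewrite y_gt0/= lt_neqAle yX andbT; apply/eqP => yXe.
    have X1 : 1 <= X by rewrite /X; lra.
    have X2 : X <= X ^+ 2 by rewrite expr2 ler_peMl// (le_trans ler01).
    have : m <= del * X ^+ 2.
      rewrite -ler_pdivrMl// mulrC; apply: le_trans X2; rewrite /X; lra.
    have sT0 : 0 < 2 * (s - T) by rewrite mulr_gt0 ?subr_gt0.
    move: vm; rewrite vS /S yXe (mulrDr del).
    by have := mulr_gt0 del0 sT0; have := e1 X; have := e2 s; lra.
  exists (S s), (fun y => - r * (m * expR (- (r * y))) + 2 * del * y), (fun s => S s y),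
    (kap * (m * expR (- (r * y))) + 2 * del),
    (- kap * (m * expR (- (kap * (s - T)))) + 2 * del).
  have lin y' : is_derive (y' : R) 1 (fun y => - (r * y)) (- r).
    by apply: (derN (derM (der_cst r y') (der_id y') erefl)); ring.
  have exd y' := derM (der_cst m y')
    (@der_comp _ expR (fun y => - (r * y)) y' _ _ _ (is_derive_expR _) (lin y') erefl) erefl.
  have linT : is_derive (s : R) 1 (fun s => - (kap * (s - T))) (- kap).
    apply: (derN (derM (der_cst kap s) (derB (der_id s) (der_cst T s) erefl) erefl)).
    by ring.
  have exT := derM (der_cst m s)
    (@der_comp _ expR (fun s => - (kap * (s - T))) s _ _ _ (is_derive_expR _) linT erefl) erefl.
  split.
  + split; first near=> y'.
      apply: (derD (derD (exd y') (der_cst (m * expR (- (kap * (s - T)))) y') erefl)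
        (derM (der_cst del y') (derD (derM (der_id y') (der_id y') erefl)
        (der_cst (2 * (s - T)) y') erefl) erefl)).
      by ring.
    apply: (derD (derM (der_cst (- r) y) (exd y) erefl)
      (derM (der_cst (2 * del) y) (der_id y) erefl)).
    by rewrite -r2; ring.
  + by split => //; near=> y'.
  + apply: (derD (derD (der_cst (m * expR (- (r * y))) s) exT erefl)
        (derM (der_cst del s) (derD (der_cst (y ^+ 2) s)
        (derM (der_cst 2 s) (derB (der_id s) (der_cst T s) erefl) erefl) erefl) erefl)).
    by ring.
  + by split => //; near=> y'.
  + have fS : f (S s y) <= - (kap * S s y) by apply: fle; rewrite -vS vm ltW.
    have : 0 < kap * (del * (y ^+ 2 + 2 * (s - T))).
      apply: mulr_gt0 => //; apply: mulr_gt0 => //.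
      by rewrite ltr_pwDl ?exprn_gt0// mulr_ge0// subr_ge0 ltW.
    by move: fS; rewrite /S; lra.
- by rewrite /X; lra.
Unshelve. all: by end_near. Qed.

End SingleEdge.

(** * A front crosses a vertex *)

Section Crossing.
Context {R : realType}.

Lemma ramp_slope_bound psi Psi (th d : R) E E1 sg :
  continuous Psi -> ramp psi Psi th d E E1 sg ->
  exists C : R, 0 < C /\ forall x, 0 <= x <= d -> 0 <= E1 x <= C.
Proof.
move=> Psic rE.
have gc : continuous (fun x => Num.sqrt (2 * (Psi th - Psi (E x)))).
  move=> x; apply: (@continuous_comp _ _ _ (fun x => 2 * (Psi th - Psi (E x)))); last first.
    exact: sqrt_continuous.
  apply: cvgMr; apply: cvgB; first exact: cvg_cst.
  by apply: (@continuous_comp _ _ _ E Psi); [exact: (ramp_continuous rE)|exact: Psic].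
have [c0 _ cmax] := EVT_max (ltW (ramp_d_gt0 rE)) (continuous_subspaceT gc).
exists (Num.sqrt (2 * (Psi th - Psi (E c0))) + 1); split.
  by rewrite ltr_wpDl// sqrtr_ge0.
move=> x xd; rewrite (ramp_energy rE)// sqrtr_ge0/=.
apply: le_trans (cmax x _) _; first by rewrite in_itv.
by rewrite lerDl.
Qed.

Lemma ramp_inv0 psi Psi (th d : R) E E1 sg :
  0 < th -> ramp psi Psi th d E E1 sg -> sg 0 = 0.
Proof.
move=> th0 rE; have [sd Es _ _] := ramp_inv rE th0.
have E0 := ramp_0 rE; have d0 := ramp_d_gt0 rE.
case: (ltgtP (sg 0) 0) => // s0.
  by have := ramp_lt rE s0 (ltW d0); rewrite Es E0 ltxx.
by have := ramp_lt rE s0 (ltW sd); rewrite Es E0 ltxx.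
Qed.

Variables (f psi Psi : R -> R) (eta : R).
Hypothesis psiE : forall s, psi s = f s - eta.
Hypothesis eta_gt0 : 0 < eta.
Hypothesis Psic : continuous Psi.
Variables (thA dA : R) (A A1 sA : R -> R).
Variables (thB dB : R) (B B1 sB : R -> R).
Hypothesis rA : ramp psi Psi thA dA A A1 sA.
Hypothesis rB : ramp psi Psi thB dB B B1 sB.
Hypothesis thAB : 0 < thB < thA.
Hypothesis fthA : 0 < f thA.
Hypothesis fthB : 0 < f thB.
Hypothesis steeper : forall b, 0 <= b <= thB ->
  4 * (Psi thB - Psi b) < Psi thA - Psi b.

Let dA0 : 0 < dA := ramp_d_gt0 rA.
Let dB0 : 0 < dB := ramp_d_gt0 rB.

Section Shift.
Variables (e T1 : R).
Hypothesis e0 : 0 < e.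

Let y (s : R) := e * (s - T1).
(** The front moves with [y] being the position of its foot on the outgoing
edges, at speed [e].  On the incoming edges the profile is [A (x + ramp_offset)]
in terms of the distance [x] to the vertex, where the offset is determined by
the condition that both profiles have the same height at the vertex.  While
[y < 0] the front has not reached the vertex and the offset is [y] itself. *)
Definition ramp_offset (s : R) : R :=
  Num.min (y s) 0 + sA (B (Num.min (Num.max (y s) 0) dB)).

Let yc : continuous y.
Proof. by move=> s; apply: cvgMr; apply: cvgB; [exact: cvg_id|exact: cvg_cst]. Qed.

Lemma ramp_offset_neg s : y s <= 0 -> ramp_offset s = y s.
Proof.
move=> ys; rewrite /ramp_offset min_l// max_r// min_l ?(ltW dB0)// (ramp_0 rB).
by rewrite (ramp_inv0 _ rA) ?addr0//; case/andP: thAB => /lt_trans h /h.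
Qed.

Lemma ramp_offset_pos s : 0 <= y s -> ramp_offset s = sA (B (Num.min (y s) dB)).
Proof. by move=> ys; rewrite /ramp_offset min_r// max_l// add0r. Qed.

Lemma ramp_offset_continuous : continuous ramp_offset.
Proof.
move=> s.
have y1 : {for s, continuous (fun s => Num.min (y s) 0)}.
  by apply: (@continuous_minr R R y (fun=> 0)); [exact: yc|exact: cvg_cst].
have y2 : {for s, continuous (fun s => Num.max (y s) 0)}.
  by apply: (@continuous_maxr R R y (fun=> 0)); [exact: yc|exact: cvg_cst].
have y3 : {for s, continuous (fun s => Num.min (Num.max (y s) 0) dB)}.
  apply: (@continuous_minr R R (fun s => Num.max (y s) 0) (fun=> dB)) => //.
  exact: cvg_cst.
apply: cvgD; first exact: y1.
apply: (@continuous_comp _ _ _ (fun s => B (Num.min (Num.max (y s) 0) dB)) sA).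
  apply: (@continuous_comp _ _ _ (fun s => Num.min (Num.max (y s) 0) dB) B) => //.
  exact: (ramp_continuous rB).
have Bth : B (Num.min (Num.max (y s) 0) dB) < thA.
  by apply: le_lt_trans (ramp_le rB _) _; case/andP: thAB.
have [_ _ _ sd] := ramp_inv rA Bth.
exact: is_derive_continuous sd.
Qed.

(** At equal heights [A] is more than twice as steep as [B]: this is the
hypothesis on the energies. *)
Lemma ramp_slopes z : 0 < z <= dB ->
  [/\ 0 < sA (B z) < dA, A (sA (B z)) = B z, 0 <= B1 z & 2 * B1 z < A1 (sA (B z))].
Proof.
move=> /andP[z0 zd].
have Bz0 : 0 < B z by rewrite -(ramp_0 rB) (ramp_lt rB).
have Bzth : B z <= thB := ramp_le rB z.
have Bth : B z < thA by apply: le_lt_trans Bzth _; case/andP: thAB.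
have [sd As A1s _] := ramp_inv rA Bth.
have s0 : 0 < sA (B z).
  by apply: (ramp_gt0 rA); rewrite min_l ?(ltW sd)// As.
split => //; first by rewrite s0.
  by rewrite (ramp_energy rB) ?sqrtr_ge0// (ltW z0).
rewrite (ramp_energy rB) ?(ltW z0)// (ramp_energy rA) ?(ltW s0) ?(ltW sd)//.
rewrite As -[X in X * _](ger0_norm (ler0n _ 2)) -sqrtr_sqr -sqrtrM ?sqr_ge0//.
have st : 4 * (Psi thB - Psi (B z)) < Psi thA - Psi (B z).
  by apply: steeper; rewrite Bzth ltW.
move: A1s; rewrite (ramp_energy rA) ?(ltW s0) ?(ltW sd)// As sqrtr_gt0 => A1s.
by rewrite ltr_sqrt//; lra.
Qed.

(** The offset has a corner at [y = 0]; a smooth function that agrees with it up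
to time [s] is enough.  Its speed is at most [e] because [A] is steeper than
[B]. *)
Lemma ramp_offset_test (s : R) : exists (g : R -> R) (r : R),
  [/\ is_derive s 1 g r, 0 <= r <= e, g s = ramp_offset s &
      \forall s' \near s^'-, g s' = ramp_offset s'].
Proof.
have yd s' : is_derive (s' : R) 1 y e.
  apply: (derM (der_cst e s') (derB (der_id s') (der_cst T1 s') erefl)).
  by ring.
have [ys|ys] := leP (y s) 0.
  exists y, e; split => //; first by rewrite lexx ltW.
    by rewrite ramp_offset_neg.
  near=> s'; rewrite ramp_offset_neg//; apply: le_trans ys.
  rewrite /y ler_pM2l// lerD2r ltW//; near: s'; exact: nbhs_left_lt.
have near_pos : \forall s' \near s^'-, 0 < y s'.
  have : \forall s' \near s, 0 < y s' by move/cvgr_gt : (@yc s); apply.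
  by move=> h; rewrite near_withinE; near=> s' => _; near: s'.
have [yB|yB] := leP (y s) dB.
  have yb : 0 < y s <= dB by rewrite ys.
  have [sdA As B10 BA] := ramp_slopes yb.
  have Bth : B (y s) < thA.
    by apply: le_lt_trans (ramp_le rB _) _; case/andP: thAB.
  have [_ _ A1s sd] := ramp_inv rA Bth.
  exists (fun s' => sA (B (y s'))), ((A1 (sA (B (y s))))^-1 * (B1 (y s) * e)).
  split.
  - apply: (@der_comp _ sA (fun s' => B (y s')) s _ _ _ sd
      (der_comp (ramp_derive rB (y s)) (yd s) erefl)) => //.
  - rewrite mulrA mulr_ge0 ?(ltW e0)//=; last by rewrite mulr_ge0// invr_ge0 ltW.
    rewrite ger_pMl// mulrC ler_pdivrMr// mul1r.
    by move: BA; lra.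
  - by rewrite ramp_offset_pos ?(ltW ys)// min_l.
  - near=> s'; have ys' : 0 < y s' by near: s'.
    rewrite ramp_offset_pos ?(ltW ys')// min_l//; apply: le_trans yB.
    rewrite /y ler_pM2l// lerD2r ltW//; near: s'; exact: nbhs_left_lt.
have near_B : \forall s' \near s^'-, dB < y s'.
  have : \forall s' \near s, dB < y s' by move/cvgr_gt : (@yc s); apply.
  by move=> h; rewrite near_withinE; near=> s' => _; near: s'.
exists (fun=> sA (B dB)), 0; split.
- exact: der_cst.
- by rewrite lexx ltW.
- by rewrite ramp_offset_pos ?(ltW ys)// min_r// ltW.
- near=> s'; have ys' : dB < y s' by near: s'.
  by rewrite ramp_offset_pos ?min_r ?(ltW ys')// (le_trans (ltW dB0))// ltW.
Unshelve. all: by end_near. Qed.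

End Shift.

(** The number [l i] is the distance to the vertex of a point of the incoming edge
[i] where the solution stays above [thA], the height of the front; nothing is
assumed on the other side of this point, nor is the solution assumed to be
large anywhere else.  The front is started with its support outside of all the
incoming segments and stopped when its foot is at distance [Y]. *)
Lemma front_crosses_vertex (I : finType) (D inc : pred I) (l : I -> R) (Y : R) :
  (0 < #|[pred i | D i && inc i]|)%N ->
  (#|[pred i | D i && ~~ inc i]| <= 2 * #|[pred i | D i && inc i]|)%N ->
  (forall i, 0 < l i) -> 0 < Y ->
  exists tau : R, forall (v : I -> R -> R -> R) (T : R),
    let len i := if inc i then l i else Y in
    (forall i, D i -> rd_solution f (v i) 0 (len i)) ->
    (forall t, exists p : I -> R, (forall i, D i -> right_slope (v i t) (p i)) /\
       \sum_(i | D i) p i = 0) ->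
    (forall t i j, D i -> D j -> v i t 0 = v j t 0) ->
    (forall t i x, D i -> 0 <= x <= len i -> 0 < v i t x) ->
    (forall t i, T <= t -> D i -> inc i -> thA < v i t (l i)) ->
    forall t i x, T + tau <= t -> D i -> ~~ inc i -> 0 <= x <= Y ->
      B (Num.min (Y - x) dB) < v i t x.
Proof.
move=> nin nout l0 Y0.
have [CA [CA0 CAb]] := ramp_slope_bound Psic rA.
have [CB [CB0 CBb]] := ramp_slope_bound Psic rB.
(* slow enough for the time derivative of the front to be below the margin
   [eta] in the differential inequality *)
pose e := eta / (CA + CB + 1).
have C1 : 0 < CA + CB + 1 by lra.
have e0 : 0 < e by rewrite divr_gt0.
have eC : e * (CA + CB + 1) = eta by rewrite /e divfK// gt_eqF.
have eCA : e * CA < eta.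
  by rewrite -eC ltr_pM2l//; lra.
have eCB : e * CB < eta.
  by rewrite -eC ltr_pM2l//; lra.
pose M := \sum_i l i.
have M0 : 0 <= M by apply: sumr_ge0 => i _; exact: ltW.
have lM i : l i <= M by rewrite /M (bigD1 i)//= lerDl sumr_ge0// => j _; exact: ltW.
exists ((M + Y) / e) => v T len vs vk vV v0 vin t i x Tt Di ninc xY.
(* the front is timed so that its foot is at distance [Y] exactly at time [t] *)
pose T1 := t - Y / e.
pose y (s : R) := e * (s - T1).
have yt : y t = Y by rewrite /y /T1 subKr mulrC divfK// gt_eqF.
have yT : y T <= - M.
  have : e * (T + (M + Y) / e) <= e * t by rewrite ler_pM2l.
  have -> : e * (T + (M + Y) / e) = e * T + M + Y by field; rewrite gt_eqF.
  have -> : y T = e * T - e * t + Y by rewrite /y /T1; field; rewrite gt_eqF.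
  lra.
have yle s s' : s <= s' -> y s <= y s' by move=> ss'; rewrite /y ler_pM2l// lerD2r.
have yd (s : R) : is_derive (s : R) 1 y e.
  apply: (derM (der_cst e s) (derB (der_id s) (der_cst T1 s) erefl)).
  by ring.
have yc : continuous y by move=> s; exact: is_derive_continuous (yd s).
pose sh := ramp_offset e T1.
have shc : continuous sh by exact: ramp_offset_continuous.
have shn s : y s <= 0 -> sh s = y s by exact: ramp_offset_neg.
have shp s : 0 <= y s -> sh s = sA (B (Num.min (y s) dB)) by exact: ramp_offset_pos.
pose SA s x := A (Num.min (x + sh s) dA).
pose SB s x := B (Num.min (y s - x) dB).
pose S i s x := if inc i then SA s x else SB s x.
have fstc (z : R * R) : w.1 @[w --> z] --> z.1 by exact: cvg_fst.
have sndc (z : R * R) : w.2 @[w --> z] --> z.2 by exact: cvg_snd.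
have SAc : continuous (fun z : R * R => SA z.1 z.2).
  move=> z; apply: (@continuous_comp _ _ _ (fun z : R * R => Num.min (z.2 + sh z.1) dA) A);
    last exact: (ramp_continuous rA).
  apply: (@continuous_minr R _ (fun z : R * R => z.2 + sh z.1) (fun=> dA)); last exact: cvg_cst.
  apply: cvgD; first exact: sndc.
  by apply: (@continuous_comp _ _ _ (fun w : R * R => w.1) sh); [exact: fstc|exact: shc].
have SBc : continuous (fun z : R * R => SB z.1 z.2).
  move=> z; apply: (@continuous_comp _ _ _ (fun z : R * R => Num.min (y z.1 - z.2) dB) B);
    last exact: (ramp_continuous rB).
  apply: (@continuous_minr R _ (fun z : R * R => y z.1 - z.2) (fun=> dB)); last exact: cvg_cst.
  apply: cvgB; last exact: sndc.
  by apply: (@continuous_comp _ _ _ (fun w : R * R => w.1) y); [exact: fstc|exact: yc].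
suff : S i t x < v i t x by rewrite /S (negbTE ninc) /SB yt.
have Tt' : T <= t.
  by apply: le_trans Tt; rewrite lerDl divr_ge0 ?(ltW e0)// addr_ge0// ltW.
apply: (@comparison_below R I D f v S (fun=> 0) len T t); rewrite ?Tt' ?lexx//.
- move=> j Dj; rewrite /S; case: (inc j); [exact: SAc|exact: SBc].
- move=> j z Dj zl; apply: le_lt_trans (v0 T j z Dj zl).
  rewrite /S; move: zl; rewrite /len; case: (inc j) => /andP[z0 zl].
    apply: (ramp_min_le0 rA); rewrite shn; last by lra.
    by have := lM j; lra.
  by apply: (ramp_min_le0 rB); lra.
- move=> s j z Dj /andP[Ts st] /andP[z0 zl] vS Sv.
  have Spos : 0 < S j s z by rewrite -vS v0// z0.
  have zl' : z < len j.
    rewrite lt_neqAle zl andbT; apply/eqP => zlj; move: vS Spos.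
    rewrite /S zlj /len; case: ifPn => ij.
      move=> vS _; have := vin s j (ltW Ts) Dj ij.
      by rewrite vS ltNge (ramp_le rA).
    move=> _ /(ramp_gt0 rB); rewrite subr_gt0 -yt ltNge.
    by rewrite yle.
  have z_gt0 : 0 < z.
    rewrite lt_neqAle z0 andbT; apply/eqP => zz; rewrite -zz in vS Spos.
    have ys : 0 < y s.
      rewrite ltNge; apply/negP => ys; move: Spos; rewrite /S; case: (inc j).
        by rewrite /SA add0r shn// => /(ramp_gt0 rA); rewrite ltNge ys.
      by rewrite /SB subr0 => /(ramp_gt0 rB); rewrite ltNge ys.
    pose zb := Num.min (y s) dB.
    have zbb : 0 < zb <= dB by rewrite /zb lt_min ys dB0 ge_min lexx orbT.
    have [/andP[sh0 shd] shB B1ge0 steep] := ramp_slopes zbb.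
    have shE : sh s = sA (B zb) by rewrite shp// ltW.
    rewrite -shE in sh0 shd shB steep.
    have S0 k : S k s 0 = B zb.
      rewrite /S; case: (inc k); rewrite /SA /SB ?subr0//.
      by rewrite add0r min_l// ltW.
    have [p [pk psum]] := vk s.
    pose c k := if inc k then A1 (sh s) else - B1 zb.
    have Sslope k : right_slope (S k s) (c k).
      rewrite /S /c; case: (inc k).
        apply: (@right_slope_near _ _ (fun x => A (x + sh s))).
        - near=> w; rewrite /SA min_l// -lerBrDr ltW//.
          by near: w; apply: nbhs_right_lt; rewrite subr_gt0.
        - by rewrite /SA add0r min_l// ltW.
        - apply: is_derive_right_slope.
          apply: (@der_comp _ A (fun x => x + sh s) 0 _ _ _ (ramp_derive rA _)
            (derD (der_id 0) (der_cst (sh s) 0) erefl)).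
          by rewrite add0r addr0 mulr1.
      rewrite /zb; have [yB|yB] := leP (y s) dB.
        apply: (@right_slope_near _ _ (fun x => B (y s - x))).
        - near=> w; rewrite /SB min_l//; apply: le_trans yB; rewrite gerBl.
          by near: w; exact: nbhs_right_ge.
        - by rewrite /SB subr0 min_l.
        - apply: is_derive_right_slope.
          apply: (@der_comp _ B (fun x => y s - x) 0 _ _ _ (ramp_derive rB _)
            (derB (der_cst (y s) 0) (der_id 0) erefl)).
          by rewrite subr0 sub0r mulrN1.
      apply: (@right_slope_near _ _ (fun x => thB)).
      - near=> w; rewrite /SB min_r ?(ramp_d rB)// lerBrDl -lerBrDr ltW//.
        by near: w; apply: nbhs_right_lt; rewrite subr_gt0.
      - by rewrite /SB subr0 min_r ?(ramp_d rB)// ltW.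
      - rewrite (ramp_energy rB) ?lexx ?(ltW dB0)// (ramp_d rB) subrr mulr0 sqrtr0 oppr0.
        by apply: is_derive_right_slope; exact: der_cst.
    have len0 k : 0 < len k by rewrite /len; case: (inc k).
    have cp k : D k -> c k <= p k.
      move=> Dk; rewrite -subr_ge0.
      apply: (@right_slope_ge0 _ (fun x => v k s x - S k s x)).
      - exact: right_slopeB (pk k Dk) (Sslope k).
      - by rewrite (vV s k j)// vS !S0 subrr.
      - near=> w; rewrite subr_ge0; apply: Sv => //; apply/andP; split; near: w.
          exact: nbhs_right_ge.
        by apply: nbhs_right_le.
    have csum : \sum_(k | D k) c k =
        A1 (sh s) *+ #|[pred i | D i && inc i]| - B1 zb *+ #|[pred i | D i && ~~ inc i]|.
      rewrite (bigID inc)/= -mulNrn -!sumr_const; congr (_ + _).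
        by apply: eq_big => // k /andP[_ ik]; rewrite /c ik.
      by apply: eq_big => // k /andP[_ ik]; rewrite /c (negbTE ik).
    have : \sum_(k | D k) c k <= 0 by rewrite -[X in _ <= X]psum; exact: ler_sum.
    rewrite csum leNgt => /negP; apply.
    rewrite subr_gt0; apply: (@le_lt_trans _ _ ((2 * B1 zb) *+ #|[pred i | D i && inc i]|)).
      by rewrite mulr_natl -mulrnA ler_wpMn2l.
    by rewrite ltrMn2r nin.
  split; first by rewrite z_gt0.
  move: Spos; rewrite /S; case: (inc j) => Spos.
    have zsh : 0 < z + sh s by apply: (ramp_gt0 rA).
    have [zd|zd] := leP (z + sh s) dA.
      have [g [r [gd /andP[r0 re] gs gsh]]] := ramp_offset_test T1 e0 s.
      have zdd : 0 < z + sh s <= dA by rewrite zsh.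
      have SE : SA s z = A (z + sh s) by rewrite /SA min_l.
      exists (fun x => A (x + sh s)), (fun x => A1 (x + sh s)), (fun s' => A (z + g s')),
        (- psi (A (z + sh s))), (A1 (z + sh s) * r); split.
      + have xd w := derD (der_id w) (der_cst (sh s) w) erefl.
        split; first near=> w.
          apply: (@der_comp _ A (fun x => x + sh s) _ _ _ _ (ramp_derive rA _) (xd w)).
          by rewrite addr0 mulr1.
        apply: (@der_comp _ A1 (fun x => x + sh s) _ _ _ _ (ramp_derive2 rA zdd) (xd z)).
        by rewrite addr0 mulr1.
      + by split => //; near=> w; exact: (ramp_plateau _ rA).
      + apply: (@der_comp _ A (fun s' => z + g s') s _ _ _ _ (derD (der_cst z s) gd erefl)).
          by rewrite gs; exact: (ramp_derive rA).
        by rewrite add0r.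
      + split; first by rewrite gs SE.
        near=> s'; rewrite (_ : g s' = sh s'); first exact: (ramp_plateau _ rA).
        by near: s'; exact: gsh.
      + rewrite psiE SE opprB subrK.
        have /andP[A0 AC] : 0 <= A1 (z + sh s) <= CA by apply: CAb; rewrite (ltW zsh).
        apply: le_lt_trans eCA; rewrite mulrC.
        by apply: ler_pM.
    have SE : SA s z = thA by rewrite /SA min_r ?(ramp_d rA)// ltW.
    exists (fun=> thA), (fun=> 0), (fun=> thA), 0, 0; split.
    + by split; [near=> w; exact: der_cst|exact: der_cst].
    + split => //; near=> w; rewrite /SA min_r ?(ramp_d rA)// ltW//.
      by rewrite -ltrBlDr; near: w; apply: lt_nbhsr; rewrite ltrBlDr.
    + exact: der_cst.
    + split => //.
      have nsh : \forall s' \near s, dA - z < sh s'.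
        by move/cvgr_gt : (shc s); apply; rewrite ltrBlDl.
      rewrite near_withinE; near=> s' => _; rewrite /SA min_r ?(ramp_d rA)//.
      rewrite -lerBlDl ltW//; near: s'; exact: nsh.
    + by rewrite SE add0r.
  have zy : 0 < y s - z by apply: (ramp_gt0 rB).
  have [zd|zd] := leP (y s - z) dB.
    have zdd : 0 < y s - z <= dB by rewrite zy.
    have SE : SB s z = B (y s - z) by rewrite /SB min_l.
    exists (fun x => B (y s - x)), (fun x => - B1 (y s - x)), (fun s' => B (y s' - z)),
      (- psi (B (y s - z))), (B1 (y s - z) * e); split.
    + have xd w := derB (der_cst (y s) w) (der_id w) erefl.
      split; first near=> w.
        apply: (@der_comp _ B (fun x => y s - x) _ _ _ _ (ramp_derive rB _) (xd w)).
        by rewrite sub0r mulrN1.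
      apply: (derN (@der_comp _ B1 (fun x => y s - x) _ _ _ _ (ramp_derive2 rB zdd) (xd z) erefl)).
      by rewrite sub0r mulrN1 opprK.
    + by split => //; near=> w; exact: (ramp_plateau _ rB).
    + apply: (@der_comp _ B (fun s' => y s' - z) s _ _ _ (ramp_derive rB _)
        (derB (yd s) (der_cst z s) erefl)).
      by rewrite subr0.
    + by split => //; near=> s'; exact: (ramp_plateau _ rB).
    + rewrite psiE SE opprB subrK.
      have /andP[B0 BC] : 0 <= B1 (y s - z) <= CB by apply: CBb; rewrite (ltW zy).
      by apply: le_lt_trans eCB; rewrite mulrC ler_pM2l.
  have SE : SB s z = thB by rewrite /SB min_r ?(ramp_d rB)// ltW.
  exists (fun=> thB), (fun=> 0), (fun=> thB), 0, 0; split.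
  + by split; [near=> w; exact: der_cst|exact: der_cst].
  + split => //; near=> w; rewrite /SB min_r ?(ramp_d rB)// ltW//.
    rewrite ltrBrDl -ltrBrDr; near: w; apply: lt_nbhsl.
    by rewrite ltrBrDl -ltrBrDr.
  + exact: der_cst.
  + split => //.
    have ny : \forall s' \near s, dB + z < y s'.
      by move/cvgr_gt : (yc s); apply; rewrite -ltrBrDr.
    rewrite near_withinE; near=> s' => _; rewrite /SB min_r ?(ramp_d rB)//.
    rewrite lerBrDr ltW//; near: s'; exact: ny.
  + by rewrite SE add0r.
- by rewrite /len (negbTE ninc).
Unshelve. all: by end_near. Qed.

End Crossing.

(** * The ends of the edges at a vertex *)

Section HalfEdges.
Context {R : realType} (G : metric_graph R).

(** Every edge contributes one half-edge at each of its ends, with the distance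
to this end as coordinate; a loop contributes two at the same vertex.  In these
coordinates all edges at a vertex are outgoing and the Kirchhoff condition is a
single sum. *)
Definition halfedge : finType := ((mg_inner G + mg_inner G) + mg_outer G)%type.

Definition he_root (h : halfedge) : mg_vertex G :=
  match h with
  | inl (inl b) => mg_src b
  | inl (inr b) => mg_tgt b
  | inr o => mg_root o
  end.

Definition he_fun (w : mg_edge G -> R -> R) (h : halfedge) (x : R) : R :=
  match h with
  | inl (inl b) => w (inl b) x
  | inl (inr b) => w (inl b) (mg_len b - x)
  | inr o => w (inr o) x
  end.

Definition he_fits (h : halfedge) (X : R) : Prop :=
  match h with
  | inl (inl b) | inl (inr b) => X <= mg_len b
  | inr _ => True
  end.

Variables (f : R -> R) (u : R -> mg_edge G -> R -> R).
Hypothesis us : entire_solution f u.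

Lemma edge_rd (e : mg_edge G) (X : R) :
  (forall x, 0 <= x <= X -> edge_set e x) ->
  (forall x, 0 < x < X -> edge_interior e x) ->
  rd_solution f (fun t => u t e) 0 X.
Proof.
move=> es ei; split.
  have ec : {within [set z | edge_set e z.2],
      continuous (fun z : R * R => u z.1 e z.2)} by exact: es_continuous us _.
  by apply: continuous_subspaceW ec => z /= /es.
move=> t; exists (derive1 (u t e)); split.
  move=> y /ei yi; apply: DeriveDef; first exact: (es_derivable_x us yi).
  by rewrite derive1E.
move=> x /ei xi; exists (derive1 (derive1 (u t e)) x); split.
  apply: DeriveDef; first exact: (es_derivable_xx us xi).
  by rewrite derive1E.
rewrite -(es_eq us)//; apply: DeriveDef; first exact: (es_derivable_t us xi).
by rewrite derive1E.
Qed.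

Lemma inner_rd (b : mg_inner G) :
  rd_solution f (fun t => u t (inl b)) 0 (mg_len b).
Proof. by apply: edge_rd => x; rewrite /= in_itv. Qed.

Lemma outer_rd (o : mg_outer G) (X : R) : rd_solution f (fun t => u t (inr o)) 0 X.
Proof.
by apply: edge_rd => x /andP[x0 _]; rewrite /= in_itv/= andbT.
Qed.

Lemma he_rd (h : halfedge) (X : R) : he_fits h X ->
  rd_solution f (fun t => he_fun (u t) h) 0 X.
Proof.
case: h => [[b|b]|o] /= bX.
- by apply: rd_solution_sub (inner_rd b).
- by apply: rd_solution_sub (rd_solution_reflect (inner_rd b)).
- exact: outer_rd.
Qed.

Lemma he_vertex (t : R) (h k : halfedge) : he_root h = he_root k ->
  he_fun (u t) h 0 = he_fun (u t) k 0.
Proof.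
have [wV [wi wo]] := es_vertices us t.
have he j : he_fun (u t) j 0 = wV (he_root j).
  case: j => [[b|b]|o] /=; last exact: wo.
    by have [] := wi b.
  by rewrite subr0; have [] := wi b.
by rewrite !he => ->.
Qed.

Lemma he_set (h : halfedge) (X x : R) (P : R -> Prop) w : he_fits h X ->
  0 <= x <= X -> (forall e y, edge_set e y -> P (w e y)) -> P (he_fun w h x).
Proof.
move=> + /andP[x0 xX] Pw; case: h => [[b|b]|o] /= bX; apply: Pw;
  rewrite /= in_itv/=; apply/andP; split=> //.
- by rewrite (le_trans xX).
- by rewrite subr_ge0 (le_trans xX).
- by rewrite gerBl.
Qed.

Lemma within_right_slope (A : set R) (g : R -> R) (d : R) :
  (\forall y \near 0^'+, A y) -> is_derive_within A g 0 d -> right_slope g d.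
Proof.
move=> A0 gd; rewrite /right_slope.
have -> : (fun y => (g y - g 0) / y) = (fun y => (g y - g 0) / (y - 0)).
  by apply/funext => y; rewrite subr0.
move=> P /gd; rewrite /= /within /= => nP.
have nP' : \forall y \near (0 : R), y != 0 -> A y -> P ((g y - g 0) / (y - 0)).
  exact: nP.
suff : \forall y \near 0^'+, P ((g y - g 0) / (y - 0)) by [].
near=> y.
have h1 : y != 0 -> A y -> P ((g y - g 0) / (y - 0)).
  by near: y; rewrite near_withinE; near=> y => _; near: y.
apply: h1; first by rewrite gt_eqF//; near: y; exact: nbhs_right_gt.
by near: y.
Unshelve. all: by end_near. Qed.

Lemma within_right_slope_end (L : R) (g : R -> R) (d : R) : 0 < L ->
  is_derive_within `[0, L] g L d -> right_slope (fun x => g (L - x)) (- d).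
Proof.
move=> L0 gd; rewrite /right_slope subr0.
have -> : (fun x => (g (L - x) - g L) / x) =
    (fun x => - ((g (L - x) - g L) / (L - x - L))).
  apply/funext => x; rewrite addrAC subrr sub0r invrN; ring.
apply: cvgN => P /gd; rewrite /= /within /= => nP.
have nP' : \forall y \near L, y != L -> `[0, L]%classic y -> P ((g y - g L) / (y - L)).
  exact: nP.
have tL : L - x @[x --> 0] --> L.
  by rewrite -[X in _ --> X]subr0; apply: cvgB; [exact: cvg_cst|exact: cvg_id].
have nP2 := tL _ nP'.
suff : \forall x \near 0^'+, P ((g (L - x) - g L) / (L - x - L)) by [].
near=> x.
have x0 : 0 < x by near: x; exact: nbhs_right_gt.
have xL : x < L by near: x; exact: nbhs_right_lt.
have h1 : L - x != L -> `[0, L]%classic (L - x) ->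
    P ((g (L - x) - g L) / (L - x - L)).
  by near: x; rewrite near_withinE; near=> x => _; near: x; exact: nP2.
apply: h1.
  by rewrite lt_eqF// gtrBl.
by rewrite /= in_itv/= subr_ge0 ltW//= gerBl ltW.
Unshelve. all: by end_near. Qed.

Lemma he_kirchhoff (t : R) : exists p : halfedge -> R,
  (forall h, right_slope (he_fun (u t) h) (p h)) /\
  forall v, \sum_(h | he_root h == v) p h = 0.
Proof.
have [p [pd _ pk]] := es_kirchhoff us t.
exists (fun h => match h with
  | inl (inl b) => p (inl b) 0
  | inl (inr b) => - p (inl b) (mg_len b)
  | inr o => p (inr o) 0
  end); split.
  case=> [[b|b]|o] /=.
  - apply: (@within_right_slope `[0, mg_len b]%classic); last first.
      apply: (pd (inl b)); rewrite /= in_itv/= lexx ltW//; exact: mg_len_gt0.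
    near=> y; rewrite /= in_itv/=; apply/andP; split; near: y.
      exact: nbhs_right_ge.
    by apply: nbhs_right_le; exact: mg_len_gt0.
  - apply: within_right_slope_end; first exact: mg_len_gt0.
    apply: (pd (inl b)); rewrite /= in_itv/= lexx andbT ltW//; exact: mg_len_gt0.
  - apply: (@within_right_slope `[0, +oo[%classic); last first.
      by apply: (pd (inr o)); rewrite /= in_itv/= lexx.
    near=> y; rewrite /= in_itv/= andbT; near: y.
    exact: nbhs_right_ge.
move=> v; rewrite -[RHS](pk v) /halfedge big_sumType/= big_sumType/=.
by [].
Unshelve. all: by end_near. Qed.

End HalfEdges.

(** * The bistable nonlinearity *)

Section Bistable.
Context {R : realType} (f : R -> R) (a : R).
Hypothesis fb : bistable f a.

Lemma bistable_continuous : continuous f.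
Proof.
move=> s; apply: differentiable_continuous; apply/derivable1_diffP.
exact: bistable_derivable fb s.
Qed.

Lemma potential_derive (s : R) : is_derive s 1 (potential f) (f s).
Proof. exact: is_derive_potential bistable_continuous. Qed.

Lemma potential_continuous : continuous (potential f).
Proof. by move=> s; exact: is_derive_continuous (potential_derive s). Qed.

Lemma potential_MVT (x y : R) : x < y ->
  exists2 z, x < z < y & potential f y - potential f x = f z * (y - x).
Proof.
move=> xy; have [|z + ->] := MVT xy (fun z _ => potential_derive z).
  exact: continuous_subspaceT potential_continuous.
by rewrite in_itv/=; exists z.
Qed.

Lemma potential_decr (x y : R) : 0 <= x -> x < y -> y <= a ->
  potential f y < potential f x.
Proof.
move=> x0 xy ya; have [z /andP[xz zy] E] := potential_MVT xy.
rewrite -subr_lt0 E nmulr_rlt0 ?subr_gt0//; apply: (bistable_neg fb).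
by rewrite (le_lt_trans x0)//= (lt_le_trans zy).
Qed.

Lemma potential_incr (x y : R) : a <= x -> x < y -> y <= 1 ->
  potential f x < potential f y.
Proof.
move=> ax xy y1; have [z /andP[xz zy] E] := potential_MVT xy.
rewrite -subr_gt0 E mulr_gt0 ?subr_gt0//; apply: (bistable_pos fb).
by rewrite (le_lt_trans ax)//= (lt_le_trans zy).
Qed.

Lemma potential_min (s : R) : 0 <= s <= 1 -> potential f a <= potential f s.
Proof.
move=> /andP[s0 s1]; case: (ltgtP s a) => [sa|as_|->//].
  by rewrite ltW// potential_decr.
by rewrite ltW// potential_incr.
Qed.

Lemma potential_a_lt0 : potential f a < 0.
Proof. by rewrite -(potential0 f) potential_decr// (bistable_a_gt0 fb). Qed.

Lemma potential_surj (y : R) : potential f a < y < potential f 1 ->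
  exists2 s, a < s < 1 & potential f s = y.
Proof.
move=> /andP[ay y1]; have a1 := bistable_a_lt1 fb.
have [|c + cE] := IVT (ltW a1) (continuous_subspaceT potential_continuous) (v := y).
  by rewrite ge_min le_max !(ltW ay) !(ltW y1) orbT.
rewrite in_itv/= => /andP[]; rewrite !le_eqVlt.
move=> /predU1P[ac|ac] /predU1P[c1|c1].
- by move: a1; rewrite ac c1 ltxx.
- by move: ay; rewrite ac cE ltxx.
- by move: y1; rewrite -c1 cE ltxx.
- by exists c => //; rewrite ac.
Qed.

(** Near [th] the reaction is bounded below by a positive constant; away from it
the potential is below its value at [th] by a fixed amount.  A small [eta]
spoils neither. *)
Lemma energy_gap (th : R) : a < th < 1 -> 0 < potential f th ->
  exists2 eta0, 0 < eta0 & forall eta, 0 < eta < eta0 -> eta < f th /\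
    forall s : R, 0 <= s < th -> potential f s - eta * s < potential f th - eta * th.
Proof.
move=> /andP[ath th1] Fth; have a0 := bistable_a_gt0 fb.
pose b := (a + th) / 2.
have ab : a < b by rewrite /b; lra.
have bth : b < th by rewrite /b; lra.
have [m mb mmin] := EVT_min (ltW bth) (continuous_subspaceT bistable_continuous).
have fm0 : 0 < f m.
  by apply: (bistable_pos fb); move: mb; rewrite in_itv/=; lra.
have Fb : potential f b < potential f th by apply: potential_incr; lra.
pose g := potential f th - Num.max 0 (potential f b).
have g0 : 0 < g by rewrite subr_gt0 gt_max Fth.
exists (Num.min (f m) g); first by rewrite lt_min fm0.
move=> eta /andP[eta0]; rewrite lt_min => /andP[etam etag]; split.
  by apply: lt_le_trans etam _; apply: mmin; rewrite in_itv/= lexx ltW.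
move=> s /andP[s0 sth].
suff : eta * (th - s) < potential f th - potential f s.
  by rewrite mulrBr; clear; lra.
have [sb|bs] := leP s b.
  have e1 : eta * (th - s) <= eta by rewrite ger_pMr//; lra.
  apply: (le_lt_trans e1); apply: (lt_le_trans etag); rewrite /g lerD2l lerN2 le_max.
  have [sa|as_] := leP s a; last first.
    move: sb; rewrite le_eqVlt => /predU1P[->|sb]; first by rewrite lexx orbT.
    by rewrite (ltW (potential_incr (ltW as_) sb _)) ?orbT//; lra.
  move: s0; rewrite le_eqVlt => /predU1P[<-|s0]; first by rewrite potential0 lexx.
  by rewrite -(potential0 f) (ltW (potential_decr (lexx _) s0 sa)).
have [z /andP[sz zth] ->] := potential_MVT sth.
rewrite ltr_pM2r ?subr_gt0//; apply: lt_le_trans etam _.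
by apply: mmin; rewrite in_itv/= (ltW zth) ltW// (lt_trans bs).
Qed.

(** With [del] the value of F(1) + 3 F(a), take F(thB) = del / 16, F(thA) = F(1) -
del / 4 and eta <= del / 16.  The last inequality is worst where F is minimal,
at [b = a]. *)
Lemma passing_parameters : 0 < potential f 1 + 3 * potential f a ->
  exists eta thA thB : R, let Psi s := potential f s - eta * s in
  [/\ 0 < eta, a < thB, thB < thA, thA < 1 &
   [/\ eta < f thA /\ (forall s : R, 0 <= s < thA -> Psi s < Psi thA),
       eta < f thB /\ (forall s : R, 0 <= s < thB -> Psi s < Psi thB) &
       forall b : R, 0 <= b <= thB -> 4 * (Psi thB - Psi b) < Psi thA - Psi b]].
Proof.
set del := _ + _ => del0.
have Fa := potential_a_lt0; have a0 := bistable_a_gt0 fb.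
have [thB /andP[aB B1] FB] : exists2 s, a < s < 1 & potential f s = del / 16.
  apply: potential_surj; rewrite /del in del0 *; lra.
have [thA /andP[aA A1] FA] : exists2 s, a < s < 1 & potential f s = potential f 1 - del / 4.
  apply: potential_surj; rewrite /del in del0 *; lra.
have BA : thB < thA.
  rewrite ltNge; apply/negP; rewrite le_eqVlt => /predU1P[E|AB].
    by move: FA; rewrite E FB /del in del0 *; lra.
  have := potential_incr (ltW aA) AB (ltW B1).
  by rewrite FA FB /del in del0 *; lra.
have [||eA eA0 etaA] := @energy_gap thA; first by rewrite aA.
  by rewrite FA /del in del0 *; lra.
have [||eB eB0 etaB] := @energy_gap thB; first by rewrite aB.
  by rewrite FB; lra.
pose eta := Num.min (Num.min eA eB) (del / 8) / 2.
have m0 : 0 < Num.min (Num.min eA eB) (del / 8) by rewrite !lt_min eA0 eB0; lra.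
have eta0 : 0 < eta by rewrite /eta; lra.
have mA : Num.min (Num.min eA eB) (del / 8) <= eA by rewrite !ge_min lexx.
have mB : Num.min (Num.min eA eB) (del / 8) <= eB by rewrite !ge_min lexx orbT.
have mD : Num.min (Num.min eA eB) (del / 8) <= del / 8 by rewrite !ge_min lexx orbT.
exists eta, thA, thB; split => //; split.
- by apply: etaA; rewrite eta0/= /eta; lra.
- by apply: etaB; rewrite eta0/= /eta; lra.
- move=> b /andP[b0 bB].
  have Fb : potential f a <= potential f b by apply: potential_min; lra.
  have h1 : eta * thA <= eta by rewrite ger_pMr// ltW.
  have h2 : 0 <= eta * thB by rewrite mulr_ge0// ltW// (lt_trans a0).
  have h3 : eta * b <= eta.
    by rewrite ger_pMr// (le_trans bB)// (le_trans (ltW BA))// ltW.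
  have h4 : eta <= del / 16 by move: mD; rewrite /eta; clear; lra.
  by move: h1 h2 h3 h4 Fb del0; rewrite FA FB /del; clear; lra.
Qed.
End Bistable.

(** * The front-like solution at very negative times *)

Section Fronts.
Context {R : realType} (G : metric_graph R).
Variables (f phi : R -> R) (a c : R) (i : mg_outer G).
Variable u : R -> mg_edge G -> R -> R.
Hypothesis tw : traveling_wave f a phi c.
Hypothesis fl : front_like_solution f phi c i u.

Lemma front_approx (eps : R) : 0 < eps -> exists t0 : R, forall t, t <= t0 ->
  (forall x, 0 <= x -> `|u t (inr i) x - phi (- x - c * t)| < eps) /\
  (forall e x, e <> inr i -> edge_set e x -> u t e x < eps).
Proof.
move=> eps0.
have := fl_limit fl; move=> /cvgr_lt/(_ _ eps0)[t0 [_ ht0]].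
exists (t0 - 1) => t tt0.
have {ht0} : _ < eps := ht0 t _; rewrite /=.
set A := [set _ | _ in _]; set B := [set y | _] => /(_ _) AB.
have {}AB : sup A + sup B < eps by apply: AB; lra.
have rng := fl_range fl t.
have Aub : has_ubound A.
  exists 1 => _ [x xi <-]; have := rng (inr i) x xi; have := tw_range tw (- x - c * t).
  by rewrite ler_norml; lra.
have Bub : has_ubound B.
  exists 1 => _ [e [x [_ xe ->]]]; have := rng _ _ xe.
  by rewrite ler_norml; lra.
have A0 : 0 <= sup A.
  have A0x : A `|u t (inr i) 0 - phi (- 0 - c * t)|.
    by exists 0 => //=; rewrite in_itv/= lexx.
  exact: le_trans (normr_ge0 _) (ub_le_sup Aub A0x).
have B0 : 0 <= sup B.
  have [[y [e [x [ei xe yE]]]]|nB] := pselect (B !=set0).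
    apply: le_trans (ub_le_sup Bub (_ : B y)); first by rewrite yE normr_ge0.
    by exists e, x.
  suff -> : B = set0 by rewrite sup0.
  by apply/eqP/negPn/negP => /set0P.
split=> [x x0|e x ei xe].
  apply: le_lt_trans AB; apply: (@le_trans _ _ (sup A)); last by rewrite lerDl.
  by apply: ub_le_sup => //; exists x => //=; rewrite in_itv/= x0.
apply: le_lt_trans (ler_norm _) _.
apply: le_lt_trans AB; apply: (@le_trans _ _ (sup B)); last by rewrite lerDr.
by apply: ub_le_sup => //; exists e, x.
Qed.

Lemma front_plateau (th : R) : th < 1 -> exists t0 X : R, 0 <= X /\
  forall x, X <= x -> th < u t0 (inr i) x.
Proof.
move=> th1; pose eps := (1 - th) / 2.
have eps0 : 0 < eps by rewrite divr_gt0// subr_gt0.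
have [t0 /(_ t0 (lexx _))[ht0 _]] := front_approx eps0.
have : 1 - eps < 1 by rewrite gtrBl.
move/cvgr_gt : (tw_left tw) => /[apply] -[Z [_ hZ]].
exists t0, (Num.max 0 (- Z - c * t0 + 1)); split; first by rewrite le_max lexx.
move=> x; rewrite ge_max => /andP[x0 xZ].
have := ht0 x x0; rewrite ltr_norml.
have := hZ (- x - c * t0); rewrite /= => h.
have {}h : 1 - eps < phi (- x - c * t0) by apply: h; lra.
by rewrite /eps in h *; lra.
Qed.

End Fronts.

(** * Propagation of lower bounds through a vertex *)

Section Passing.
Context {R : realType} (f : R -> R) (eta : R) (thA dA thB dB : R).
Variables (Psi A A1 sA B B1 sB : R -> R).
Let psi s := f s - eta.
Hypothesis eta_gt0 : 0 < eta.
Hypothesis Psic : continuous Psi.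
Hypothesis rA : ramp psi Psi thA dA A A1 sA.
Hypothesis rB : ramp psi Psi thB dB B B1 sB.
Hypothesis thAB : 0 < thB < thA.
Hypothesis f_gt0 : forall s, thB <= s <= thA -> 0 < f s.
Hypothesis steeper : forall b, 0 <= b <= thB ->
  4 * (Psi thB - Psi b) < Psi thA - Psi b.
Context (G : metric_graph R) (u : R -> mg_edge G -> R -> R).
Hypothesis us : entire_solution f u.
Hypothesis u_gt0 : forall t e x, edge_set e x -> 0 < u t e x.

Lemma vertex_step (vtx : mg_vertex G) (inc : pred (halfedge G))
    (l : halfedge G -> R) (Y T : R) :
  (0 < #|[pred h | (he_root h == vtx) && inc h]|)%N ->
  (#|[pred h | (he_root h == vtx) && ~~ inc h]| <=
    2 * #|[pred h | (he_root h == vtx) && inc h]|)%N ->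
  (forall h, 0 < l h) -> dB <= Y ->
  (forall h, he_root h = vtx -> inc h -> he_fits h (l h)) ->
  (forall h, he_root h = vtx -> ~~ inc h -> he_fits h Y) ->
  (forall t h, T <= t -> he_root h = vtx -> inc h -> thA < he_fun (u t) h (l h)) ->
  exists T', forall t h x, T' <= t -> he_root h = vtx -> ~~ inc h ->
    0 <= x <= Y - dB -> thB < he_fun (u t) h x.
Proof.
move=> nin nout l0 dY fitl fitY act.
have dB0 := ramp_d_gt0 rB.
have Y0 : 0 < Y by apply: lt_le_trans dY.
have fA : 0 < f thA by apply: f_gt0; rewrite lexx andbT ltW//; case/andP: thAB.
have fB : 0 < f thB by apply: f_gt0; rewrite lexx ltW//; case/andP: thAB.
have [tau ctau] := front_crosses_vertex (fun s => erefl (psi s)) eta_gt0 Psic rA rB thAB fA fB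
  steeper nin nout l0 Y0.
pose len h := if inc h then l h else Y.
have fit h : he_root h = vtx -> he_fits h (len h).
  by rewrite /len; case: ifPn => [ih hv|ih hv]; [exact: fitl|exact: fitY].
exists (T + tau) => t h x Tt hv nh xb.
have -> : thB = B (Num.min (Y - x) dB) by rewrite min_r ?(ramp_d rB)//; lra.
apply: (ctau (fun h t => he_fun (u t) h) T) => //.
- by move=> k /eqP kv; apply: he_rd => //; exact: fit.
- move=> s; have [p [pd pk]] := he_kirchhoff us s; exists p; split => //.
- by move=> s k k' /eqP kv /eqP k'v; apply: (he_vertex us); rewrite kv k'v.
- by move=> s k y /eqP kv yl; exact: (@he_set _ _ k _ y (fun r => 0 < r) (u s) (fit k kv) yl (u_gt0 s)).
- by move=> s k Ts /eqP kv ik; exact: act.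
- by apply/eqP.
- lra.
Qed.

(** An outgoing edge of length at least [2 * rho + dB] carries the plateau of the
front on [[0, 2 * rho]], which is what lifting the solution at distance [rho]
from the vertex requires. *)
Lemma vertex_activation (vtx : mg_vertex G) (inc : pred (halfedge G))
    (l : halfedge G -> R) (rho tau T : R) :
  (forall (v : R -> R -> R) (x0 T : R),
      rd_solution f v (x0 - rho) (x0 + rho) ->
      (forall t x, T <= t -> x0 - rho <= x <= x0 + rho -> thB < v t x) ->
      forall t, T + tau <= t -> thA < v t x0) ->
  0 < rho ->
  (0 < #|[pred h | (he_root h == vtx) && inc h]|)%N ->
  (#|[pred h | (he_root h == vtx) && ~~ inc h]| <=
    2 * #|[pred h | (he_root h == vtx) && inc h]|)%N ->
  (forall h, 0 < l h) ->
  (forall h, he_root h = vtx -> inc h -> he_fits h (l h)) ->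
  (forall h, he_root h = vtx -> ~~ inc h -> he_fits h (2 * rho + dB)) ->
  (forall t h, T <= t -> he_root h = vtx -> inc h -> thA < he_fun (u t) h (l h)) ->
  exists T', forall t h, T' <= t -> he_root h = vtx -> ~~ inc h ->
    thA < he_fun (u t) h rho.
Proof.
move=> raised rho0 nin nout l0 fitl fitY act.
have dY : dB <= 2 * rho + dB by rewrite lerDr mulr_ge0// ltW.
have [T' step] := vertex_step nin nout l0 dY fitl fitY act.
exists (T' + tau) => t h Tt hv nh.
apply: (raised (fun t => he_fun (u t) h) rho T') => //.
  apply: (@rd_solution_sub _ _ _ 0 (2 * rho + dB)); first by rewrite subrr.
    by have := ramp_d_gt0 rB; lra.
  by apply: (he_rd us); exact: fitY.
by move=> s x Ts xb; apply: step => //; lra.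
Qed.

End Passing.

(** * The front from the first outer path passes *)

Section OneWay.
Context {R : realType}.

Lemma index_enum_inner_edge : index_enum inner_edge =
  [:: P1Q1; P1Q2; Q1P2a; Q1P2b; Q2P2a; Q2P2b].
Proof. by rewrite [index_enum _]unlock unlock. Qed.

Lemma index_enum_outer_path : index_enum outer_path = [:: Omega1; Omega2].
Proof. by rewrite [index_enum _]unlock unlock. Qed.

Lemma card_halfedge (len : inner_edge -> R) (len_gt0 : forall e, 0 < len e)
    (P : pred (halfedge (one_way_graph len_gt0))) :
  #|[pred h | P h]| = (\sum_(b <- [:: P1Q1; P1Q2; Q1P2a; Q1P2b; Q2P2a; Q2P2b])
     P (inl (inl b)) + \sum_(b <- [:: P1Q1; P1Q2; Q1P2a; Q1P2b; Q2P2a; Q2P2b])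
     P (inl (inr b)) + \sum_(o <- [:: Omega1; Omega2]) P (inr o))%N.
Proof.
rewrite -sum1_card big_mkcond/= /halfedge big_sumType/= big_sumType/=.
rewrite -index_enum_inner_edge -index_enum_outer_path.
by congr (_ + _ + _)%N; apply: eq_bigr => b _; rewrite inE/=; case: (P _).
Qed.

Lemma propagation_passes (f : R -> R) (a : R) (phi : R -> R) (c : R) :
  bistable f a -> traveling_wave f a phi c ->
  0 < potential f 1 + 3 * potential f a ->
  exists2 L0 : R, 0 < L0 &
    forall (len : inner_edge -> R) (len_gt0 : forall e, 0 < len e),
    (forall e, L0 <= len e) ->
    propagation_index (G := one_way_graph len_gt0) f phi c Omega1 Omega2 1.
Proof.
move=> fb tw Fpos.
have a0 := bistable_a_gt0 fb.
have fc := bistable_continuous fb.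
have [eta [thA [thB [eta0 aB BA A1 [[fA PsiA] [fB PsiB] steep]]]]] :=
  passing_parameters fb Fpos.
pose psi s := f s - eta; pose Psi s := potential f s - eta * s.
have Psid (x : R) : is_derive (x : R) 1 Psi (psi x).
  apply: (derB (potential_derive fb x) (derM (der_cst eta x) (der_id x) erefl)).
  by rewrite /psi; ring.
have Psic : continuous Psi by move=> x; exact: is_derive_continuous (Psid x).
have thB0 : 0 < thB by apply: lt_trans aB.
have thA0 : 0 < thA by apply: lt_trans BA.
have [dA [A [A' [sA rA]]]] : exists d E E1 sg, ramp psi Psi thA d E E1 sg.
  by apply: ramp_exists => //; rewrite subr_gt0.
have [dB [B [B' [sB rB]]]] : exists d E E1 sg, ramp psi Psi thB d E E1 sg.
  by apply: ramp_exists => //; rewrite subr_gt0.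
have thAB : 0 < thB < thA by rewrite thB0.
have fpos s : thB <= s <= thA -> 0 < f s.
  move=> /andP[sB' sA']; apply: (bistable_pos fb).
  by rewrite (lt_le_trans aB)//= (le_lt_trans sA').
have [rho [tau [rho0 tau0 raised]]] := raise_lower_bound fc BA fpos.
have dB0 := ramp_d_gt0 rB; have dA0 := ramp_d_gt0 rA.
exists (2 * rho + dB); first by lra.
move=> len len_gt0 lenL u w fl lim.
pose G := one_way_graph len_gt0.
have us := fl_solution fl.
have u01 t (e : mg_edge G) x : edge_set e x -> 0 < u t e x < 1 by exact: (fl_range fl).
have u_gt0 t e x : edge_set e x -> 0 < u t e x by move=> /(u01 t)/andP[].
have dist_gt0 b : 0 < len b - rho by have := lenL b; lra.
have dist_fits b : len b - rho <= len b by lra.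
have act := vertex_activation eta0 Psic rA rB thAB fpos steep us u_gt0 raised rho0.
(* the starting point of the chain of lower bounds; the successive ones are for
   the edges that leave P1, Q1 and Q2, at distance [rho] from these vertices *)
have [T0 [X0 [X00 T0P]]] : exists T X : R, 0 < X /\
    forall t, T <= t -> thA < u t (inr Omega1) X.
  have [T [X [X0 XP]]] := front_plateau tw fl A1.
  exists T, (X + dA + 1); split; first by lra.
  apply: (bump_persists (f := f) rA (v := fun t => u t (inr Omega1))) => //.
  - by move=> s; rewrite /psi gtrBl.
  - by apply: fpos; rewrite lexx ltW.
  - by apply: (@rd_solution_sub _ _ _ 0 (X + 2 * dA + 2)) => //; exact: outer_rd.
  - by move=> t x _ /andP[xX _]; apply: u_gt0; rewrite /= in_itv/= andbT (le_trans X0).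
  - by move=> x /andP[xX _]; exact: XP.
have [T1 T1P] : exists T, forall t b, T <= t -> inner_edge_src b = P1 ->
    thA < u t (inl b) rho.
  have [||||||T TP] := act P1 (pred1 (inr Omega1)) (fun=> X0) T0 => //.
  - by rewrite !card_halfedge !big_cons !big_nil.
  - by rewrite !card_halfedge !big_cons !big_nil.
  - by move=> h _ /eqP ->.
  - by move=> [[b|b]|o]//= _ _; exact: lenL.
  - by move=> t h Tt _ /eqP ->; exact: T0P.
  by exists T => t b Tt bP; exact: (TP t (inl (inl b))).
have [T2 T2P] : exists T, forall t b, T <= t -> inner_edge_src b = Q1 ->
    thA < u t (inl b) rho.
  have [||||||T TP] := act Q1 (pred1 (inl (inr P1Q1))) (fun=> len P1Q1 - rho) T1 => //.
  - by rewrite !card_halfedge !big_cons !big_nil.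
  - by rewrite !card_halfedge !big_cons !big_nil.
  - by move=> h _ /eqP ->; exact: dist_fits.
  - by move=> [[b|b]|o]//= _ _; exact: lenL.
  - by move=> t h Tt _ /eqP -> /=; rewrite subKr; exact: T1P.
  by exists T => t b Tt bP; exact: (TP t (inl (inl b))).
have [T3 T3P] : exists T, forall t b, T <= t -> inner_edge_src b = Q2 ->
    thA < u t (inl b) rho.
  have [||||||T TP] := act Q2 (pred1 (inl (inr P1Q2))) (fun=> len P1Q2 - rho) T1 => //.
  - by rewrite !card_halfedge !big_cons !big_nil.
  - by rewrite !card_halfedge !big_cons !big_nil.
  - by move=> h _ /eqP ->; exact: dist_fits.
  - by move=> [[b|b]|o]//= _ _; exact: lenL.
  - by move=> t h Tt _ /eqP -> /=; rewrite subKr; exact: T1P.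
  by exists T => t b Tt bP; exact: (TP t (inl (inl b))).
pose l (h : halfedge G) := if h is inl (inr b) then len b - rho else 1.
have T4P Y : dB <= Y -> exists T, forall t x, T <= t -> 0 <= x <= Y - dB ->
    thB < u t (inr Omega2) x.
  move=> dY.
  have [|||||||T TP] := vertex_step eta0 Psic rA rB thAB fpos steep us u_gt0
    (vtx := P2) (inc := predC1 (inr Omega2)) (l := l) (Y := Y) (T := Num.max T2 T3) => //.
  - by rewrite !card_halfedge !big_cons !big_nil.
  - by rewrite !card_halfedge !big_cons !big_nil.
  - by move=> [[b|b]|o] /=.
  - by move=> [[[]|b]|[]]//= _ _; exact: dist_fits.
  - by move=> [[b|b]|o]//= _.
  - move=> t h; rewrite ge_max => /andP[t2 t3].
    by case: h => [[[]|[]]|[]]//= _ _; rewrite subKr; [exact: T2P|exact: T2P|exact: T3P|exact: T3P].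
  by exists T => t x Tt xY; apply: (TP t (inr Omega2)) => //=; rewrite eqxx.
have wle x : 0 <= x -> w (inr Omega2) x <= 1.
  move=> x0; have xe : edge_set (inr Omega2 : mg_edge G) x by rewrite /= in_itv/= x0.
  have wl : u t (inr Omega2) x @[t --> +oo] --> w (inr Omega2) x by exact: lim.
  apply: (@ler_cvg_to _ (pinfty_nbhs R) _ _ (fun t => u t (inr Omega2) x) (fun=> 1) _ 1 wl (cvg_cst _)).
  by near=> t; have /andP[_ /ltW] := u01 t _ _ xe.
have wge q : thB < q -> q < 1 -> exists X, forall x, X <= x -> q <= w (inr Omega2) x.
  move=> Bq q1.
  have fq s : thB <= s <= q -> 0 < f s.
    move=> /andP[sB' sq]; apply: (bistable_pos fb).
    by rewrite (lt_le_trans aB)//= (le_lt_trans sq).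
  have [r [ta [r0 ta0 Hr]]] := raise_lower_bound fc Bq fq.
  exists r => x rx; have x0 : 0 <= x by apply: le_trans rx; exact: ltW.
  have xe : edge_set (inr Omega2 : mg_edge G) x by rewrite /= in_itv/= x0.
  have [|T TP] := T4P (x + r + dB); first by rewrite lerDr addr_ge0// ltW.
  have wl : u t (inr Omega2) x @[t --> +oo] --> w (inr Omega2) x by exact: lim.
  apply: (@ler_cvg_to _ (pinfty_nbhs R) _ _ (fun=> q) (fun t => u t (inr Omega2) x) q _ (cvg_cst _) wl).
  near=> t; have Tt : T + ta <= t by near: t; apply: nbhs_pinfty_ge; rewrite num_real.
  apply: ltW; apply: (Hr (fun t => u t (inr Omega2)) x T) => //.
  - apply: (@rd_solution_sub _ _ _ 0 (x + r)) => //; first by rewrite subr_ge0.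
    exact: outer_rd.
  - by move=> s y Ts yb; apply: TP => //; move: yb rx; clear; lra.
apply/cvgrPdist_le => eps eps0.
pose q := Num.max (1 - eps) ((1 + thB) / 2).
have qB : thB < q by rewrite lt_max; apply/orP; right; lra.
have q1 : q < 1 by rewrite gt_max; apply/andP; split; move: eps0 BA A1; clear; lra.
have [X XP] := wge q qB q1.
near=> x.
have x0 : 0 <= x by near: x; apply: nbhs_pinfty_ge; rewrite num_real.
have xX : X <= x by near: x; apply: nbhs_pinfty_ge; rewrite num_real.
have := wle x x0; have := XP x xX; rewrite /q ge_max => /andP[h1 _] h2.
by rewrite ler_norml; move: h1 h2 eps0; clear; lra.
Unshelve. all: by end_near. Qed.

End OneWay.

(** * Stationary supersolutions on a metric graph *)

Section StationarySupersolution.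
Context {R : realType} (G : metric_graph R).
Variables (f : R -> R) (u : R -> mg_edge G -> R -> R).
Variables (S : mg_edge G -> R -> R) (M t0 : R).
Hypothesis us : entire_solution f u.
Hypothesis u01 : forall t e x, edge_set e x -> 0 < u t e x < 1.
Hypothesis len1 : forall b : mg_inner G, 1 <= mg_len b.
Hypothesis M0 : 0 <= M.
Hypothesis fM : forall x y, 0 <= x -> x <= y -> y <= 1 -> f y <= f x + M * (y - x).
Hypothesis Sc : forall e, continuous (S e).
Hypothesis S0 : forall e x, edge_set e x -> 0 <= S e x.
Hypothesis Sint : forall e x, edge_interior e x -> S e x < 1 ->
  exists (P P1 : R -> R) (q : R),
    [/\ (\forall y \near x, is_derive (y : R) 1 P (P1 y)) /\ is_derive x 1 P1 q,
        P x = S e x, (\forall y \near x, S e y <= P y) & q + f (S e x) <= 0].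
Variable sl : halfedge G -> R.
Hypothesis Ssl : forall h, right_slope (he_fun S h) (sl h).
Hypothesis Skirchhoff : forall v, \sum_(h | he_root h == v) sl h <= 0.
Hypothesis Svertex : forall h k : halfedge G, he_root h = he_root k ->
  he_fun S h 0 = he_fun S k 0.
Hypothesis Sinit : forall e x, edge_set e x -> u t0 e x <= S e x.

(* The function [bump] grows at infinity on the outer paths, and at every end
   of every edge it is 2 and decreases into the edge: a small multiple of it,
   growing exponentially in time, turns [S] into a strict supersolution that
   also satisfies a strict Kirchhoff inequality and lies above the solution
   outside of a compact set. *)
Let rate (e : mg_edge G) : R := if e is inl b then (mg_len b)^-1 else 1.
Let bump (e : mg_edge G) (x : R) : R := 2 - rate e * x + (rate e * x) ^+ 2.
Let he_rate (h : halfedge G) : R :=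
  match h with inl (inl b) | inl (inr b) => (mg_len b)^-1 | inr _ => 1 end.

Let rate01 e : 0 < rate e <= 1.
Proof.
case: e => [b|o] /=; last by rewrite ltr01 lexx.
have L0 := lt_le_trans ltr01 (len1 b).
by rewrite invr_gt0 L0/= invf_le1// len1.
Qed.

Let he_rate_gt0 h : 0 < he_rate h.
Proof.
by case: h => [[b|b]|o] //=; rewrite invr_gt0 (lt_le_trans ltr01).
Qed.

Let bump_gt1 e x : 1 < bump e x.
Proof.
rewrite /bump; set w := rate e * x.
have : 0 <= (w - 1 / 2) ^+ 2 by exact: sqr_ge0.
by rewrite !expr2; lra.
Qed.

Let he_bump h x : he_fun bump h x = 2 - he_rate h * x + (he_rate h * x) ^+ 2.
Proof.
case: h => [[b|b]|o] //=; rewrite /bump/=.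
have L0 : mg_len b != 0 by rewrite gt_eqF// (lt_le_trans ltr01).
by field.
Qed.

Let bump_derive e x : is_derive (x : R) 1 (bump e) (- rate e + 2 * rate e ^+ 2 * x).
Proof.
have h := derM (der_cst (rate e) x) (der_id x) erefl.
apply: (derD (derB (der_cst 2 x) h erefl) (derM h h erefl)).
by ring.
Qed.

Let bump_derive2 e x :
  is_derive (x : R) 1 (fun x => - rate e + 2 * rate e ^+ 2 * x) (2 * rate e ^+ 2).
Proof.
apply: (derD (der_cst (- rate e) x) (derM (der_cst (2 * rate e ^+ 2) x) (der_id x) erefl)).
by ring.
Qed.

Let he_bump_slope h : right_slope (he_fun bump h) (- he_rate h).
Proof.
have -> : he_fun bump h = (fun x => 2 - he_rate h * x + (he_rate h * x) ^+ 2).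
  by apply/funext => x; rewrite he_bump.
apply: is_derive_right_slope.
have d := derM (der_cst (he_rate h) 0) (der_id 0) erefl.
apply: (derD (derB (der_cst 2 0) d erefl) (derM d d erefl)).
by ring.
Qed.

(** The values of [S] that are at least 1 need no inequality, because the solution
is below 1. *)
Lemma stationary_supersolution t e x : t0 <= t -> edge_set e x -> u t e x <= S e x.
Proof.
move=> t0t ex; apply/ler_addgt0Pr => eps eps0.
(* [M] controls the reaction term; [bump] has second derivative at most 2 and
   is larger than 1 *)
pose K := M + 2.
pose E0 s := expR (K * (s - t0)).
have E0_gt0 s : 0 < E0 s by exact: expR_gt0.
have bump_gt0 j y : 0 < bump j y by apply: lt_trans (bump_gt1 j y).
pose del := eps / (E0 t * bump e x).
have del0 : 0 < del by rewrite divr_gt0// mulr_gt0.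
pose SF (j : mg_edge G) (s y : R) := S j y + del * E0 s * bump j y.
have x0 : 0 <= x by case: (e) ex => [b|o]; rewrite /= in_itv/= => /andP[].
(* truncation of the outer paths: [del * bump X >= del * X >= 1] *)
pose X := x + del^-1 + 1.
have X0 : 0 < X by rewrite /X ltr_wpDl// addr_ge0// invr_ge0 ltW.
pose be (j : mg_edge G) := if j is inl b then mg_len b else X.
have be0 j : 0 < be j by case: j => [b|o] //=; exact: lt_le_trans (len1 b).
have be_set j y : 0 <= y <= be j -> edge_set j y.
  by case: j => [b|o]; rewrite /= in_itv//= => /andP[->].
have be_int j y : 0 < y < be j -> edge_interior j y.
  by case: j => [b|o]; rewrite /= in_itv//= => /andP[->].
have E0S s : is_derive (s : R) 1 E0 (K * E0 s).
  apply: (@der_comp _ expR (fun s => K * (s - t0)) _ _ _ _ (is_derive_expR _)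
    (derM (der_cst K s) (derB (der_id s) (der_cst t0 s) erefl) erefl)).
  by rewrite /E0; ring.
suff : u t e x < SF e t x.
  move=> /ltW; rewrite /SF /del -mulrA divfK// gt_eqF// mulr_gt0//.
pose I : finType := (mg_inner G + mg_outer G)%type.
apply: (@comparison_above R I xpredT f (fun j s y => u s j y) SF (fun=> 0) be t0 t) => //.
- by move=> [b|o] _; [exact: inner_rd|exact: outer_rd].
- move=> j _ z.
  have fstc : w.1 @[w --> z] --> z.1 by exact: cvg_fst.
  have sndc : w.2 @[w --> z] --> z.2 by exact: cvg_snd.
  apply: cvgD.
    by apply: (@continuous_comp _ _ _ (fun w : R * R => w.2) (S j)); [exact: sndc|exact: Sc].
  apply: cvgM.
    apply: cvgMr; apply: (@continuous_comp _ _ _ (fun w : R * R => w.1) E0); first exact: fstc.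
    exact: is_derive_continuous (E0S _).
  apply: (@continuous_comp _ _ _ (fun w : R * R => w.2) (bump j)); first exact: sndc.
  exact: is_derive_continuous (bump_derive _ _).
- move=> j y _ /be_set yj; apply: le_lt_trans (Sinit yj) _.
  by rewrite /SF ltrDl; apply: mulr_gt0 => //; apply: mulr_gt0.
- move=> s j y _ /andP[t0s st] yb uS Sle.
  have ySet := be_set _ _ yb.
  have uu := u01 s ySet.
  pose cc := del * E0 s.
  have cc0 : 0 < cc by rewrite mulr_gt0.
  have SFE k z : SF k s z = S k z + cc * bump k z by [].
  have zz0 : 0 < cc * bump j y by rewrite mulr_gt0.
  have S1 : S j y < 1 by move: uS uu; rewrite SFE; lra.
  have vertex_contact h : he_fun (u s) h 0 = he_fun (SF^~ s) h 0 -> False.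
    move=> hc.
    have heSF k z : he_fun (SF^~ s) k z = he_fun S k z + cc * he_fun bump k z.
      by case: k => [[b|b]|o].
    have [p [pd pk]] := he_kirchhoff us s.
    have ge k : he_root k = he_root h -> 0 <= sl k - cc * he_rate k - p k.
      move=> kh; apply: (@right_slope_ge0 _
          (fun z => he_fun (SF^~ s) k z - he_fun (u s) k z)).
      - apply: right_slopeB (pd k).
        have -> : he_fun (SF^~ s) k =
            (fun z => he_fun S k z - (- cc) * he_fun bump k z).
          by apply/funext => z; rewrite heSF mulNr opprK.
        have -> : sl k - cc * he_rate k = sl k - (- cc) * (- he_rate k) by rewrite mulrNN.
        have bs : right_slope (fun z => - cc * he_fun bump k z) (- cc * (- he_rate k)).
          exact: (right_slopeZ (@he_bump_slope k)).
        exact: (right_slopeB (@Ssl k) bs).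
      - rewrite (he_vertex us s kh) hc !heSF (Svertex kh) !he_bump !mulr0.
        by rewrite subrr.
      - case: k {kh} => [[b|b]|o].
        + have L0 := lt_le_trans ltr01 (len1 b).
          near=> z; rewrite subr_ge0; apply: (Sle (inl b)) => //=.
          apply/andP; split; near: z; first exact: nbhs_right_ge.
          exact: nbhs_right_le.
        + have L0 := lt_le_trans ltr01 (len1 b).
          near=> z; rewrite subr_ge0; apply: (Sle (inl b)) => //=.
          rewrite subr_ge0 gerBl; apply/andP; split; near: z; last exact: nbhs_right_ge.
          exact: nbhs_right_le.
        + near=> z; rewrite subr_ge0; apply: (Sle (inr o)) => //=.
          apply/andP; split; near: z; first exact: nbhs_right_ge.
          exact: nbhs_right_le.
    have : 0 <= \sum_(k | he_root k == he_root h) (sl k - cc * he_rate k - p k).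
      by apply: sumr_ge0 => k /eqP; exact: ge.
    rewrite !sumrB pk subr0 -mulr_sumr.
    have rate_pos : 0 < \sum_(k | he_root k == he_root h) he_rate k.
      rewrite (bigD1 h)//=; apply: ltr_pwDl => //.
      by apply: sumr_ge0 => k _; exact: ltW.
    have := Skirchhoff (he_root h); have := mulr_gt0 cc0 rate_pos; lra.
  have /andP[y0 yX] := yb.
  have y_gt0 : 0 < y.
    rewrite lt_neqAle y0 andbT; apply/eqP => ye.
    case: (j) uS => [b|o]; rewrite -ye => uS.
      exact: (vertex_contact (inl (inl b))).
    exact: (vertex_contact (inr o)).
  have y_lt : y < be j.
    rewrite lt_neqAle yX andbT; apply/eqP => ye.
    move: uS uu S0; rewrite ye {zz0 S1 ySet}; case: (j) => [b|o] /= uS uu S0'.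
      by apply: (vertex_contact (inl (inr b))); rewrite /= subr0.
    have E1 : 1 <= E0 s by rewrite -expR0 ler_expR mulr_ge0 ?subr_ge0 ?(ltW t0s)// /K addr_ge0.
    have bX : X <= bump (inr o) X.
      rewrite /bump/= mul1r; have : 0 <= (X - 1) ^+ 2 by exact: sqr_ge0.
      by rewrite !expr2; lra.
    have dX : 1 <= del * X.
      rewrite /X !mulrDr mulfV ?gt_eqF// mulr1.
      by have := mulr_ge0 (ltW del0) x0; lra.
    have : del * X <= cc * bump (inr o) X.
      rewrite /cc -mulrA ler_pM2l//; apply: le_trans bX _.
      by rewrite ler_peMl// ltW.
    have := S0' (inr o) X; rewrite /= in_itv/= (ltW X0) => /(_ isT).
    by move: uS uu; rewrite SFE; lra.
  have yint : 0 < y < be j by rewrite y_gt0.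
  split; first exact: yint.
  have [P [P1 [q [[Pd P1d] Py PS qf]]]] := Sint (be_int _ _ yint) S1.
  exists (fun z => P z + cc * bump j z),
    (fun z => P1 z + cc * (- rate j + 2 * rate j ^+ 2 * z)), (fun s => SF j s y),
    (q + cc * (2 * rate j ^+ 2)), (K * (cc * bump j y)).
  split.
  + split; first near=> z.
      have Pz : is_derive (z : R) 1 P (P1 z) by near: z.
      by apply: (derD Pz (derM (der_cst cc z) (bump_derive j z) erefl)); ring.
    by apply: (derD P1d (derM (der_cst cc y) (bump_derive2 j y) erefl)); ring.
  + split; first by rewrite SFE Py.
    by near=> z; rewrite SFE lerD2r; near: z.
  + apply: (derD (der_cst (S j y) s) (derM (derM (der_cst del s) (E0S s) erefl)
      (der_cst (bump j y) s) erefl)).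
    by rewrite /cc; ring.
  + by split => //; near=> z.
  + have Sy0 := S0 ySet.
    have fS : f (SF j s y) <= f (S j y) + M * (cc * bump j y).
      have -> : cc * bump j y = SF j s y - S j y by rewrite SFE addrC addKr.
      apply: fM => //; last by move: uu; rewrite -uS => /andP[_ /ltW].
      by rewrite SFE lerDl ltW.
    have /andP[r0 r1] := rate01 j.
    have r2 : rate j ^+ 2 <= 1 by rewrite expr_le1// ltW.
    have : cc * (2 * rate j ^+ 2) < 2 * (cc * bump j y).
      rewrite mulrCA ltr_pM2l// ltr_pM2l//; exact: le_lt_trans r2 _.
    by rewrite /K mulrDl; lra.
- by rewrite t0t lexx.
- rewrite x0/= /be; case: (e) ex => [b|o]; rewrite /= in_itv/=; first by case/andP.
  by move=> _; rewrite /X -addrA lerDl addr_ge0// invr_ge0 ltW.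
Unshelve. all: by end_near. Qed.

End StationarySupersolution.

(** * The front from the second outer path is blocked *)

Section Blocking.
Context {R : realType}.

Section Constants.
Context (f : R -> R) (a : R).
Hypothesis fb : bistable f a.

Lemma bistable_lipschitz : exists2 M : R, 0 <= M &
  forall x y, 0 <= x -> x <= y -> y <= 1 -> f y <= f x + M * (y - x).
Proof.
have [c0 _ cmax] := EVT_max ler01 (continuous_subspaceT (bistable_C1 fb)).
exists (Num.max 0 (derive1 f c0)); first by rewrite le_max lexx.
move=> x y x0 xy y1; rewrite -lerBlDl.
have fd z : is_derive (z : R) 1 f (derive1 f z).
  apply: DeriveDef; first exact: (bistable_derivable fb).
  by rewrite derive1E.
have [|z zxy ->] := MVT_segment xy (fun z _ => fd z).
  exact: continuous_subspaceT (bistable_continuous fb).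
rewrite ler_wpM2r ?subr_ge0//; apply: le_trans (cmax z _) _; last first.
  by rewrite le_max lexx orbT.
by move: zxy; rewrite !in_itv/=; lra.
Qed.

(** Since F(0) = 0 the inequality F(1) - F(a) < 16 (F(m) - F(a)) holds for
[m = 0], with a margin [del] that is shared between [m] and [eta]. *)
Lemma blocking_parameters : potential f 1 + 15 * potential f a < 0 ->
  exists m kap eta : R, [/\ 0 < m < a, 0 < kap, 0 < eta,
    forall s, 0 <= s <= m -> f s <= - (kap * s) &
    potential f 1 - potential f a + eta * (1 - a) <
      16 * (potential f m - potential f a)].
Proof.
move=> Fneg; have a0 := bistable_a_gt0 fb; have a1 := bistable_a_lt1 fb.
have df0 := bistable_df0 fb.
have fd0 : is_derive (0 : R) 1 f (derive1 f 0).
  apply: DeriveDef; first exact: (bistable_derivable fb).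
  by rewrite derive1E.
have [k [kE kc k0]] := (is_derive1_caratheodory _ _ _).1 fd0.
pose del := - (potential f 1 + 15 * potential f a).
have del0 : 0 < del by rewrite oppr_gt0.
pose kap := - derive1 f 0 / 2.
have kap0 : 0 < kap by rewrite divr_gt0// oppr_gt0.
have nk : \forall s \near (0 : R), k s < - kap.
  by move/cvgr_lt : kc; apply; rewrite k0 /kap; lra.
have nF : \forall s \near (0 : R), - (del / 32) < potential f s.
  move/cvgr_gt : (@potential_continuous _ _ _ fb 0); apply.
  by rewrite potential0 oppr_lt0 divr_gt0.
have [e /= e0 eP] : exists2 e : R, 0 < e & forall s, `|s| < e ->
    k s < - kap /\ - (del / 32) < potential f s.
  have /nbhs_ballP[e /= e0 eb] : \forall s \near (0 : R),
      k s < - kap /\ - (del / 32) < potential f s.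
    by near=> s; split; near: s.
  by exists e => // s se; apply: eb; rewrite /ball/= sub0r normrN.
pose m := Num.min (e / 2) (a / 2).
have m0 : 0 < m by rewrite lt_min !divr_gt0.
have me : m <= e / 2 by rewrite ge_min lexx.
have ma : m <= a / 2 by rewrite ge_min lexx orbT.
exists m, kap, (del / 2); split => //.
- by rewrite m0/=; lra.
- by rewrite divr_gt0.
- move=> s /andP[s0 sm]; have [|ks _] := eP s; first by rewrite ger0_norm//; lra.
  have := kE s; rewrite (bistable_f0 fb) !subr0 => ->.
  by rewrite -mulNr ler_wpM2r// ltW.
- have [|_ Fm] := eP m; first by rewrite gtr0_norm//; lra.
  have : del / 2 * (1 - a) <= del / 2 by rewrite ger_pMr//; lra.
  by rewrite /del in Fm *; lra.
Unshelve. all: by end_near. Qed.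

End Constants.

Lemma propagation_blocked (f : R -> R) (a : R) (phi : R -> R) (c : R) :
  bistable f a -> traveling_wave f a phi c ->
  potential f 1 + 15 * potential f a < 0 ->
  exists2 L0 : R, 0 < L0 &
    forall (len : inner_edge -> R) (len_gt0 : forall e, 0 < len e),
    (forall e, L0 <= len e) ->
    propagation_index (G := one_way_graph len_gt0) f phi c Omega2 Omega1 0.
Proof.
move=> fb tw Fneg.
have a0 := bistable_a_gt0 fb; have a1 := bistable_a_lt1 fb.
have fc := bistable_continuous fb.
have [m [kap [eta [/andP[m0 ma] kap0 eta0 fkap steep]]]] := blocking_parameters fb Fneg.
have [M M0 fM] := bistable_lipschitz fb.
have fm : f m < 0 by apply: (bistable_neg fb); rewrite m0.
(* the supersolution on the four edges at P2 is [a - E], at distance [x] from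
   P2; it falls from [a] to [m] *)
pose psiE s := - f (a - s); pose PsiE s := potential f (a - s).
have PsiEd (x : R) : is_derive (x : R) 1 PsiE (psiE x).
  apply: (@der_comp _ (potential f) (fun s => a - s) _ _ _ _ (potential_derive fb _)
    (derB (der_cst a x) (der_id x) erefl)).
  by rewrite /psiE; ring.
have [dE [E [E1 [sE rE]]]] : exists d E E1 sg, ramp psiE PsiE (a - m) d E E1 sg.
  apply: ramp_exists => //; rewrite ?subr_gt0//.
    by rewrite /psiE subKr oppr_gt0.
  move=> s /andP[s0 sm]; rewrite /PsiE subKr.
  by apply: (potential_decr fb); move: s0 sm m0; clear; lra.
(* on the second outer path it is [a + Z]; the margin [eta] is there because
   f(1) = 0: without it the level 1 would not be reached at a finite distance *)
pose psiZ s := f (a + s) + eta; pose PsiZ s := potential f (a + s) + eta * s.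
have PsiZd (x : R) : is_derive (x : R) 1 PsiZ (psiZ x).
  apply: (derD (@der_comp _ (potential f) (fun s => a + s) _ _ _ _ (potential_derive fb _)
    (derD (der_cst a x) (der_id x) erefl) erefl) (derM (der_cst eta x) (der_id x) erefl)).
  by rewrite /psiZ; ring.
have [dZ [Z [Z1 [sZ rZ]]]] : exists d E E1 sg, ramp psiZ PsiZ (1 - a) d E E1 sg.
  apply: ramp_exists => //; rewrite ?subr_gt0//.
    by rewrite /psiZ subrKC (bistable_f1 fb) add0r.
  move=> s /andP[s0 sm]; rewrite /PsiZ subrKC; apply: ltrD; last by rewrite ltr_pM2l.
  by apply: (potential_incr fb); move: s0 sm a0; clear; lra.
have dE0 := ramp_d_gt0 rE; have dZ0 := ramp_d_gt0 rZ.
have slopes0 : Z1 0 <= 4 * E1 0.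
  rewrite (ramp_energy rZ) ?lexx ?(ltW dZ0)// (ramp_energy rE) ?lexx ?(ltW dE0)//.
  rewrite (ramp_0 rZ) (ramp_0 rE) /PsiZ /PsiE subrKC subKr subr0 addr0 mulr0 addr0.
  rewrite -[X in _ <= X * _](ger0_norm (ler0n _ 4)) -sqrtr_sqr -sqrtrM ?sqr_ge0//.
  by apply: ler_wsqrtr; lra.
exists (dE + 1); first by lra.
move=> len len_gt0 lenL u w fl lim.
pose G := one_way_graph len_gt0.
have us := fl_solution fl.
have u01 t (e : mg_edge G) x : edge_set e x -> 0 < u t e x < 1 by exact: (fl_range fl).
pose SE y := a - E (Num.min y dE).
pose S (e : mg_edge G) (x : R) : R :=
  match e with
  | inl P1Q1 | inl P1Q2 | inr Omega1 => m
  | inl b => SE (len b - x)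
  | inr Omega2 => a + Z (Num.min x dZ)
  end.
have SEm y : dE <= y -> SE y = m.
  by move=> dy; rewrite /SE min_r// (ramp_d rE) subKr.
have SEge y : m <= SE y by rewrite /SE lerBrDr -lerBrDl (ramp_le rE).
have SEc : continuous SE.
  move=> y; apply: cvgB; first exact: cvg_cst.
  apply: (@continuous_comp _ _ _ (fun y => Num.min y dE) E); last exact: (ramp_continuous rE).
  by apply: (@continuous_minr R R id (fun=> dE)); [exact: cvg_id|exact: cvg_cst].
have SE_c L : continuous (fun x => SE (L - x)).
  move=> x; apply: (@continuous_comp _ _ _ (fun x => L - x) SE); last exact: SEc.
  by apply: cvgB; [exact: cvg_cst|exact: cvg_id].
have Sc e : continuous (S e).
  case: e => [[]|[]]; try exact: SE_c; try by move=> x; exact: cvg_cst.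
  move=> y; apply: cvgD; first exact: cvg_cst.
  apply: (@continuous_comp _ _ _ (fun y => Num.min y dZ) Z); last exact: (ramp_continuous rZ).
  by apply: (@continuous_minr R R id (fun=> dZ)); [exact: cvg_id|exact: cvg_cst].
have Zge x : 0 <= x -> 0 <= Z (Num.min x dZ).
  move=> x0; have : 0 <= Num.min x dZ by rewrite le_min x0 ltW.
  rewrite le_eqVlt => /predU1P[<-|xp]; first by rewrite (ramp_0 rZ).
  by rewrite -(ramp_0 rZ) ltW// (ramp_lt rZ)// ge_min lexx orbT.
have Z1E x : dZ <= x -> a + Z (Num.min x dZ) = 1.
  by move=> dx; rewrite min_r// (ramp_d rZ) subrKC.
have Sge e x : edge_set e x -> m <= S e x.
  case: e => [[]|[]]//=; rewrite ?lexx//.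
  rewrite in_itv/= andbT => /Zge; lra.
have [t0 init] : exists t0, forall e x, edge_set e x -> u t0 e x <= S e x.
  have a2 : 0 < a / 2 by rewrite divr_gt0.
  have eps0 : 0 < Num.min m (a / 2) by rewrite lt_min m0.
  have [t1 t1P] := front_approx tw fl eps0.
  have c0 := tw_speed tw.
  move/cvgr_lt : (tw_right tw) => /(_ _ a2)[z0 [_ z0P]].
  pose t0 := Num.min t1 (- (z0 + dZ + 1) / c).
  have [|far near_] := t1P t0; first by rewrite ge_min lexx.
  exists t0 => e x xe.
  have [eO|eO] := pselect (e = inr Omega2); last first.
    have := near_ e x eO xe; rewrite lt_min => /andP[um _].
    by apply: le_trans (Sge e x xe); exact: ltW.
  move: xe; rewrite eO /= => xe.
  have x0 : 0 <= x by move: xe; rewrite in_itv/= => /andP[].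
  have [dx|xd] : dZ <= x \/ x < dZ by case: (leP dZ x); [left|right].
    by rewrite Z1E//; have /andP[_ /ltW] := u01 t0 (inr Omega2) x xe.
  have := far x x0; rewrite lt_min => /andP[_]; rewrite ltr_norml => /andP[_ ux].
  have ct0 : c * t0 <= - (z0 + dZ + 1).
    by rewrite mulrC -ler_pdivlMr// ge_min lexx orbT.
  have phix : phi (- x - c * t0) < a / 2 by apply: z0P; lra.
  by have := Zge x x0; move: ux phix; clear; lra.
have Sint e x : edge_interior e x -> S e x < 1 ->
  exists (P P1 : R -> R) (q : R),
    [/\ (\forall y \near x, is_derive (y : R) 1 P (P1 y)) /\ is_derive x 1 P1 q,
        P x = S e x, (\forall y \near x, S e y <= P y) & q + f (S e x) <= 0].
  have flat g : (\forall y \near x, g y = m) -> exists (P P1 : R -> R) (q : R),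
      [/\ (\forall y \near x, is_derive (y : R) 1 P (P1 y)) /\ is_derive x 1 P1 q,
        P x = g x, (\forall y \near x, g y <= P y) & q + f (g x) <= 0].
    move=> gm; have gx : g x = m by exact: nbhs_singleton gm.
    exists (fun=> m), (fun=> 0), 0; split => //.
    - by split; [near=> y; exact: der_cst|exact: der_cst].
    - by near=> y; suff -> : g y = m by []; near: y.
    - by rewrite gx add0r ltW.
  have descent L : 0 < x < L -> exists (P P1 : R -> R) (q : R),
      [/\ (\forall y \near x, is_derive (y : R) 1 P (P1 y)) /\ is_derive x 1 P1 q,
        P x = SE (L - x), (\forall y \near x, SE (L - y) <= P y) &
        q + f (SE (L - x)) <= 0].
    move=> /andP[x0 xL]; have [dx|xd] := ltP dE (L - x).
      apply: (flat (fun y => SE (L - y))); near=> y; apply: SEm.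
      suff : y < L - dE by lra.
      by near: y; apply: lt_nbhsl; lra.
    have xdd : 0 < L - x <= dE by rewrite subr_gt0 xL.
    have ld z := derB (der_cst L z) (der_id z) erefl.
    exists (fun z => a - E (L - z)), (fun z => E1 (L - z)), (psiE (E (L - x))); split.
    - split; first near=> z.
        apply: (derB (der_cst a z)
          (@der_comp _ E (fun z => L - z) _ _ _ _ (ramp_derive rE _) (ld z) erefl)).
        by ring.
      apply: (@der_comp _ E1 (fun z => L - z) _ _ _ _ (ramp_derive2 rE xdd) (ld x)).
      by ring.
    - by rewrite /SE min_l.
    - by near=> z; rewrite /SE lerD2l lerN2; exact: (ramp_plateau _ rE).
    - by rewrite /SE min_l// /psiE addNr.
  case: e => [[]|[]] xi; try by move=> _; apply: (flat (fun=> m)); near=> y.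
  1-4: by move=> _; apply: descent; move: xi; rewrite /= in_itv.
  move=> S1; have xd : x < dZ.
    by rewrite ltNge; apply/negP => dx; move: S1; rewrite /= Z1E// ltxx.
  have x0 : 0 < x by move: xi; rewrite /= in_itv/= => /andP[].
  have xdd : 0 < x <= dZ by rewrite x0 ltW.
  exists (fun z => a + Z z), Z1, (- psiZ (Z x)); split.
  - split; last exact: (ramp_derive2 rZ).
    near=> z; apply: (derD (der_cst a z) (ramp_derive rZ z)).
    by rewrite add0r.
  - by rewrite /= min_l// ltW.
  - near=> z; rewrite /= min_l//; apply: ltW; near: z; exact: lt_nbhsl.
  - by rewrite /= min_l ?(ltW xd)// /psiZ opprD addrAC addNr add0r oppr_le0 ltW.
pose sl (h : halfedge G) : R :=
  match h with
  | inl (inr Q1P2a) | inl (inr Q1P2b) | inl (inr Q2P2a) | inl (inr Q2P2b) => - E1 0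
  | inr Omega2 => Z1 0
  | _ => 0
  end.
have flat_slope : right_slope (fun=> m) 0.
  by apply: is_derive_right_slope; exact: der_cst.
have Ssl h : right_slope (he_fun S h) (sl h).
  have top L : dE + 1 <= L -> right_slope (fun x => SE (L - x)) 0.
    move=> LL; apply: (right_slope_near (h := fun=> m)) => //; last by rewrite SEm//; lra.
    near=> y; apply: SEm.
    suff : y <= 1 by lra.
    by near: y; exact: nbhs_right_le.
  have bottom L : right_slope (fun x => SE (L - (L - x))) (- E1 0).
    apply: (right_slope_near (h := fun y => a - E y)).
    - near=> y; rewrite subKr /SE min_l//; apply: ltW; near: y; exact: nbhs_right_lt.
    - by rewrite subKr /SE min_l// ltW.
    - apply: is_derive_right_slope; apply: (derB (der_cst a 0) (ramp_derive rE 0)).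
      by rewrite sub0r.
  case: h => [[[]|[]]|[]]; try exact: flat_slope; try exact: top; try exact: bottom.
  apply: (right_slope_near (h := fun y => a + Z y)).
  - near=> y; rewrite /= min_l//; apply: ltW; near: y; exact: nbhs_right_lt.
  - by rewrite /= min_l// ltW.
  - apply: is_derive_right_slope; apply: (derD (der_cst a 0) (ramp_derive rZ 0)).
    by rewrite add0r.
have Skir v : \sum_(h | he_root h == v) sl h <= 0.
  rewrite big_mkcond/= /halfedge big_sumType/= big_sumType/=.
  rewrite index_enum_inner_edge index_enum_outer_path !big_cons !big_nil.
  by case: v => /=; move: slopes0; clear; lra.
have Sv (h k : halfedge G) : he_root h = he_root k -> he_fun S h 0 = he_fun S k 0.
  have SE0 : SE 0 = a by rewrite /SE min_l ?(ltW dE0)// (ramp_0 rE) subr0.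
  have SEl b : SE (len b) = m by apply: SEm; have := lenL b; lra.
  have val j : he_fun S j 0 = if he_root j == P2 then a else m.
    case: j => [[[]|[]]|[]] //=; rewrite ?subr0 ?subrr//.
    by rewrite min_l ?(ltW dZ0)// (ramp_0 rZ) addr0.
  by rewrite !val => ->.
have len1 b : 1 <= len b by have := lenL b; lra.
have um t x : t0 <= t -> 0 <= x -> u t (inr Omega1) x <= m.
  move=> tt x0; apply: (stationary_supersolution us u01 len1 M0 fM Sc _ Sint Ssl
    Skir Sv init tt (e := inr Omega1)).
    by move=> e y ye; apply: le_trans (Sge e y ye); exact: ltW.
  by rewrite /= in_itv/= x0.
have u_gt0 t x : 0 <= x -> 0 < u t (inr Omega1) x.
  move=> x0; have xe : edge_set (inr Omega1 : mg_edge G) x by rewrite /= in_itv/= x0.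
  by have /andP[] := u01 t _ _ xe.
have dec t x : t0 <= t -> 0 <= x -> u t (inr Omega1) x <=
    m * expR (- (Num.sqrt kap * x)) + m * expR (- (kap * (t - t0))).
  apply: (exponential_decay (v := fun t => u t (inr Omega1)) kap0 m0 fkap) => //.
    by move=> X; exact: outer_rd.
  by move=> s y ts y0; rewrite u_gt0// um.
have expR_small eps : 0 < eps -> forall y, m / eps <= y -> m * expR (- y) <= eps.
  move=> eps0 y ye; have y0 : 0 <= y by apply: le_trans ye; rewrite divr_ge0// ltW.
  rewrite expRN ler_pdivrMr ?expR_gt0// -ler_pdivrMl// mulrC.
  by apply: le_trans ye _; apply: le_trans (expR_ge1Dx y); rewrite lerDr.
have wl x : 0 <= x -> u t (inr Omega1) x @[t --> +oo] --> w (inr Omega1) x.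
  by move=> x0; apply: lim; rewrite /= in_itv/= x0.
have w_ge0 x : 0 <= x -> 0 <= w (inr Omega1) x.
  move=> x0; apply: (@ler_cvg_to _ (pinfty_nbhs R) _ _ (fun=> 0)
    (fun t => u t (inr Omega1) x) 0 _ (cvg_cst _) (wl x x0)).
  by near=> t; apply: ltW; exact: u_gt0.
have w_le x : 0 <= x -> w (inr Omega1) x <= m * expR (- (Num.sqrt kap * x)).
  move=> x0; apply/ler_addgt0Pr => eps eps0.
  apply: (@ler_cvg_to _ (pinfty_nbhs R) _ _ (fun t => u t (inr Omega1) x)
    (fun=> m * expR (- (Num.sqrt kap * x)) + eps) _ _ (wl x x0) (cvg_cst _)).
  near=> t; have tt : t0 <= t by near: t; apply: nbhs_pinfty_ge; rewrite num_real.
  apply: le_trans (dec t x tt x0) _; rewrite lerD2l; apply: expR_small => //.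
  rewrite -ler_pdivrMl// -lerBlDr opprK.
  by near: t; apply: nbhs_pinfty_ge; rewrite num_real.
apply/cvgrPdist_le => eps eps0.
near=> x.
have x0 : 0 <= x by near: x; apply: nbhs_pinfty_ge; rewrite num_real.
rewrite sub0r normrN ger0_norm ?w_ge0//; apply: le_trans (w_le x x0) _.
apply: expR_small => //; rewrite -ler_pdivrMl ?sqrtr_gt0//.
Unshelve. all: by end_near. Qed.

End Blocking.

Unset Implicit Arguments.

Theorem proposition2p24 (R : realType) (f : R -> R) (a : R)
    (phi : R -> R) (c : R)
    (f_bistable : bistable f a)
    (phi_wave : traveling_wave f a phi c)
    (F_pos : 0 < potential f 1 + (2 ^+ 2 - 1) * potential f a)
    (F_neg : potential f 1 + (4 ^+ 2 - 1) * potential f a < 0) :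
  exists L0 : R, forall (len : inner_edge -> R) (len_gt0 : forall e, 0 < len e),
    (forall e, L0 <= len e) ->
    let G := one_way_graph len_gt0 in
    propagation_index (G := G) f phi c Omega1 Omega2 1 /\
    propagation_index (G := G) f phi c Omega2 Omega1 0.
Proof.
have F3 : 0 < potential f 1 + 3 * potential f a.
  by have <- : 2 ^+ 2 - 1 = 3 :> R by ring.
have F15 : potential f 1 + 15 * potential f a < 0.
  by have <- : 4 ^+ 2 - 1 = 15 :> R by ring.
have [L1 _ pass] := propagation_passes f_bistable phi_wave F3.
have [L2 _ block] := propagation_blocked f_bistable phi_wave F15.
exists (Num.max L1 L2) => len len_gt0 lenL G; split.
  by apply: pass => e; apply: le_trans (lenL e); rewrite le_max lexx.
by apply: block => e; apply: le_trans (lenL e); rewrite le_max lexx orbT.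
Qed.
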